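(* Let $A_\infty:[t_0,\infty)\times X_p\to\mathcal L(X_1,X_0)$ be a continuous mapping such that: (i) for every $R>0$ there exists a constant $L_R^\infty>0$ such that for all $u_1,u_2\in X_p$ with $\|u_1\|_{X_p}\le R$, $\|u_2\|_{X_p}\le R$, all $v\in X_1$ and all $t\in[t_0,t_0+R]$, $$\|A_\infty(t,u_1)v-A_\infty(t,u_2)v\|_{X_0}\le L_R^\infty\,\|u_1-u_2\|_{X_p}\,\|v\|_{X_1};$$ (ii) for each $t\in[t_0,\infty)$ and each $u\in X_p$, the operator $A_\infty(t,u)$ has the property of maximal $L^p$-regularity on any compact interval. Fix $R>0$ and, for $t\in[t_0,t_0+R]$ and $u\in X_p$, let $c_{\mathrm M}(t,u):=C(A_\infty(t,u);[t_0,t_0+R])$ be the maximal regularity constant of $A_\infty(t,u)$ on $[t_0,t_0+R]$. Then the mapping $$[t_0,t_0+R]\times X_p\ni(t,u)\mapsto c_{\mathrm M}(t,u)\in\mathbb R$$ is continuous.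
   Context: $X_0,X_1$ are Banach spaces with $X_1\hookrightarrow X_0$ continuously and densely; $p\in(1,\infty)$; $t_0>0$. $\mathcal L(X_1,X_0)$ is the space of bounded linear operators from $X_1$ to $X_0$ with the operator norm; its elements are also regarded as (possibly unbounded) closed operators in $X_0$ with domain $X_1$. For an interval $I$, $E_1(I):=W^{1,p}(I;X_0)\cap L^p(I;X_1)$ and $E_0(I):=L^p(I;X_0)$, with their natural norms (the norm of $E_1(I)$ being the usual norm of the intersection, e.g. the sum of the two norms). $X_p:=(X_0,X_1)_{1-\frac1p,p}$ is the real interpolation space, with norm $\|f\|_{X_p}=\inf\{\|F\|_{E_1([0,\infty))}: f=F(0)\}$. Maximal $L^p$-regularity: for a compact interval $J=[a,a+T]$, an operator $A\in\mathcal L(X_1,X_0)$ has maximal $L^p$-regularity on $J$ if for every $f\in L^p(J;X_0)$ there exists a unique $u\in E_1(J)$ satisfying $\frac{du}{dt}+Au=f$ on $J$ (in the $L^p$-sense, i.e. almost everywhere) and $u(a)=0$. In that case there is a constant $C>0$ such that $\|u\|_{E_1(J)}\le C\|f\|_{E_0(J)}$ for all such $f$ and corresponding $u$. The maximal regularity constant $C(A;J)$ of $A$ on $J$ is the infimum of all such $C$. *)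

(* Defs.v *)
From HB Require Import structures.
From mathcomp Require Import all_boot all_order all_algebra.
From mathcomp Require Import all_classical all_reals all_analysis.

Set Implicit Arguments.
Unset Strict Implicit.
Unset Printing Implicit Defensive.

Import Order.TTheory GRing.Theory Num.Theory.
Import numFieldNormedType.Exports.

Local Open Scope classical_set_scope.
Local Open Scope ring_scope.

Section Bochner.
Context {R : realType} {X : normedModType R}.
Implicit Types (D : set R) (f : R -> X) (p : R).

Let mu : {measure set (measurableTypeR R) -> \bar R} := @lebesgue_measure R.

Definition simple_fun (s : R -> X) : Prop :=
  finite_set (range s) /\
  forall x, measurable (s @^-1` [set x] : set (measurableTypeR R)).

(* Convergence is required at every point of [D], with Borel simple functions:
   every class of a.e.-equal strongly Lebesgue measurable functions contains a
   function with this property. *)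
Definition strongly_measurable D f : Prop :=
  exists s : nat -> R -> X, (forall n, simple_fun (s n)) /\
    forall t, D t -> s n t @[n --> \oo] --> f t.

(* L^p(D; X) for 1 < p < +oo.  Elements are represented by functions on [R]
   whose values outside [D] are irrelevant; classes are never formed, and
   equality in L^p is equality almost everywhere on [D]. *)
Definition Lp_enorm p D f : \bar R :=
  Lnorm mu p%:E ((fun t => (`|f t|)%:E) \_ D).

Definition Lp p D f : Prop :=
  strongly_measurable D f /\ (Lp_enorm p D f < +oo)%E.

Definition Lp_norm p D f : R := fine (Lp_enorm p D f).

Definition ae_eq_on D f g : Prop := {ae mu, forall t, D t -> f t = g t}.

Definition integrable_simple_fun D (s : R -> X) : Prop :=
  simple_fun s /\
  forall x, x != 0 -> (mu (D `&` s @^-1` [set x]) < +oo)%E.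

(* The fibre over 0 may have infinite measure, but contributes [_ *: 0]. *)
Definition simple_integral D (s : R -> X) : X :=
  \sum_(x \in range s) fine (mu (D `&` s @^-1` [set x])) *: x.

(* "[f] is Bochner integrable on [D], with integral [v]" *)
Definition has_bochner_integral D f (v : X) : Prop :=
  strongly_measurable D f /\
  exists s : nat -> R -> X,
    [/\ forall n, integrable_simple_fun D (s n),
        (\int[mu]_(t in D) (`|f t - s n t|)%:E)%E @[n --> \oo] --> 0%E
      & simple_integral D (s n) @[n --> \oo] --> v].

End Bochner.

Section Sobolev.
Context {R : realType} {X : normedModType R}.
Implicit Types (I : set R) (u w : R -> X) (p : R).

(* C_c^oo of the interior of [I], as functions on [R] *)
Definition test_function I (phi : R -> R) : Prop :=
  (forall n t, derivable (derive1n n phi) t 1) /\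
  exists K : set R,
    [/\ compact K, K `<=` interior I & forall t, ~ K t -> phi t = 0].

Definition weak_derivative I u w : Prop :=
  forall phi, test_function I phi -> exists v : X,
    has_bochner_integral I (fun t => derive1 phi t *: u t) v /\
    has_bochner_integral I (fun t => phi t *: w t) (- v).

Definition W1p p I u : Prop :=
  Lp p I u /\ exists w, Lp p I w /\ weak_derivative I u w.

(* For [u] in [W1p p I], the derivative of [u] (unique almost everywhere). *)
Definition wderiv p I u : R -> X :=
  xget (fun=> 0) [set w | Lp p I w /\ weak_derivative I u w].

Definition W1p_norm p I u : R := Lp_norm p I u + Lp_norm p I (wderiv p I u).

(* "u(a) = x", evaluated on the continuous representative of [u] *)
Definition trace_at I u (a : R) (x : X) : Prop :=
  exists v : R -> X,
    [/\ {within I, continuous v}, ae_eq_on I v u & v a = x].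

End Sobolev.

Section MaximalRegularity.
Context {R : realType} {X0 X1 : completeNormedModType R}.
(* [iota] is the embedding of X_1 into X_0 *)
Implicit Types (iota A : X1 -> X0) (p : R) (I : set R).

(* E_1(I), the intersection of W^{1,p}(I; X_0) and L^p(I; X_1) *)
Definition E1 p iota I (u : R -> X1) : Prop :=
  W1p p I (iota \o u) /\ Lp p I u.

Definition E1_norm p iota I (u : R -> X1) : R :=
  W1p_norm p I (iota \o u) + Lp_norm p I u.

(* X_p = (X_0, X_1)_{1-1/p,p}, as the space of traces at 0 of E_1([0,+oo[) *)
Definition Xp p iota : set X0 :=
  [set f | exists F, E1 p iota `[0, +oo[ F /\
                     trace_at `[0, +oo[ (iota \o F) 0 f].

Definition Xp_norm p iota (f : X0) : R :=
  inf [set E1_norm p iota `[0, +oo[ F | F in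
        [set F | E1 p iota `[0, +oo[ F /\
                 trace_at `[0, +oo[ (iota \o F) 0 f]].

Definition op_norm A : R :=
  inf [set C | 0 <= C /\ forall v, `|A v| <= C * `|v|].

Definition is_solution p iota A (a b : R) (f : R -> X0) (u : R -> X1) : Prop :=
  [/\ E1 p iota `[a, b] u,
      ae_eq_on `[a, b] (fun t => wderiv p `[a, b] (iota \o u) t + A (u t)) f
    & trace_at `[a, b] (iota \o u) a 0].

Definition maximal_regularity p iota A (a b : R) : Prop :=
  forall f : R -> X0, Lp p `[a, b] f ->
    exists u, is_solution p iota A a b f u /\
      forall u', is_solution p iota A a b f u' -> ae_eq_on `[a, b] u' u.

Definition max_reg_const p iota A (a b : R) : R :=
  inf [set C | 0 < C /\
        forall f u, Lp p `[a, b] f -> is_solution p iota A a b f u ->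
          E1_norm p iota `[a, b] u <= C * Lp_norm p `[a, b] f].

(* Continuity on [S] x X_p (product topology, X_p with its norm) of a map into
   a space whose metric is given by [dist]. *)
Definition continuous_on_Xp p iota (S : set R) (Y : Type) (dist : Y -> Y -> R)
    (g : R -> X0 -> Y) : Prop :=
  forall t u, S t -> Xp p iota u -> forall e, 0 < e ->
    exists2 d, 0 < d &
      forall s w, S s -> Xp p iota w ->
        `|s - t| < d -> Xp_norm p iota (w - u) < d -> dist (g s w) (g t u) < e.

End MaximalRegularity.

(* Main.v *)
Require Import Defs.
From HB Require Import structures.
From mathcomp Require Import all_boot all_order all_algebra.
From mathcomp Require Import all_classical all_reals all_analysis.
From mathcomp Require Import measurable_realfun ring lra.
Import Order.TTheory GRing.Theory Num.Theory.
Import numFieldNormedType.Exports.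
Local Open Scope classical_set_scope.
Local Open Scope ring_scope.

(** Fix an interval [a, b] and write m(A) for the maximal regularity constant
of A.

Continuity of m is a perturbation argument.  If u solves u' + B u = f, then
u also solves u' + A u = f + (A - B) u with the same initial value, so that,
with delta = |A - B| and any admissible constant C for A,
    |u|_E1 <= C (|f| + delta |u|_E1).
When C delta < 1 this makes C / (1 - C delta) admissible for B
([reg_bound_perturb]).  Exchanging A and B bounds m(B) on both sides in terms
of m(A) and delta alone ([reg_const_close]), and delta is small near (t, u)
because A is continuous into L(X_1, X_0).

This is meaningful only if every operator with maximal regularity has some
admissible constant at all, that is, if its solution operator is bounded
([maximal_regularity_bounded]).  The usual proof is the closed graph theorem.
Here a gliding hump exploits that the solution operator is causal, so that
the completeness of L^p and of E_1 is never invoked: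

- if the solution operator is bounded on one interval, it is bounded on all:
  translate the interval, shrink it by extending data by zero, and glue two
  overlapping intervals by a restart with an affine cut-off
  ([solution_bounded_glue], [solution_bounded_everywhere]);
- otherwise it is unbounded on every interval.  On consecutive intervals
  J_0, J_1, ... of [0, 1], data g_n on J_n are chosen with |g_n| <= 2^-(n+1)
  and a response on J_n that exceeds by n the response to all the earlier
  data.  The function equal to g_n on each J_n is in L^p, and its solution U
  has norm at least n on [0, 1], for every n, since the data after J_n do not
  influence U on J_n.

Solutions are compared through their equation, hence through the weak
derivative, which must be unique almost everywhere.  For Bochner integrable
functions this is [du_bois_reymond]: if w is orthogonal to all test functions,
then its integrals over intervals vanish, so the mean of |w - x| over an
interval is at least |x|, for every vector x; by Lebesgue's differentiation
theorem |x| <= |w(t) - x| for almost every t, and letting x run through the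
countably many values of simple functions that converge to w gives w = 0. *)

Set Implicit Arguments.
Unset Strict Implicit.
Unset Printing Implicit Defensive.

(** * Simple functions and their integrals *)

Section SimpleFunctions.
Context {R : realType}.
Notation mu := (@lebesgue_measure R).

Lemma simple_fun_map2 (X Y Z : normedModType R) (h : X -> Y -> Z)
    (s : R -> X) (t : R -> Y) :
  simple_fun s -> simple_fun t -> simple_fun (fun r => h (s r) (t r)).
Proof.
move=> [fs ms] [ft mt]; split.
  apply: (@sub_finite_set _ _ [set h x y | x in range s & y in range t]).
    by move=> z [r _ <-]; exists (s r); [exists r|exists (t r) => //; exists r].
  exact: finite_image2.
move=> z.
rewrite [X in measurable X](_ : _ =
    \bigcup_(xy in (range s `*` range t) `&` [set xy | h xy.1 xy.2 = z])
      (s @^-1` [set xy.1] `&` t @^-1` [set xy.2])).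
  apply: fin_bigcup_measurable; last by move=> xy _; exact: measurableI.
  exact/finite_setIl/finite_setX.
apply/seteqP; split=> [r /= hr|r [[x y] /= [_ <-] [-> ->]]//].
by exists (s r, t r) => //; split => //; split; exists r.
Qed.

Lemma simple_fun_cst (X : normedModType R) (x : X) : simple_fun (cst x : R -> X).
Proof.
split; first by apply: (@sub_finite_set _ _ [set x]) => // y [r _ <-].
move=> y; have [<-|yx] := eqVneq x y.
  by rewrite (_ : _ @^-1` _ = setT)//; apply/seteqP; split.
rewrite (_ : _ @^-1` _ = set0)//; apply/seteqP; split=> // r /= xy.
by rewrite xy eqxx in yx.
Qed.

Lemma simple_fun_indic (E : set (measurableTypeR R)) : measurable E ->
  simple_fun (\1_E : R -> R^o).
Proof.
move=> mE; split.
  apply: (@sub_finite_set _ _ [set 0; 1]) => // y [r _ <-].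
  by rewrite indicE; case: (_ \in _); [right|left].
by move=> y; rewrite -[X in measurable X]setTI; apply: measurable_indic.
Qed.

Lemma simple_fun_map (X Y : normedModType R) (h : X -> Y) (s : R -> X) :
  simple_fun s -> simple_fun (fun r => h (s r)).
Proof. by move=> ss; exact: (simple_fun_map2 (fun x _ => h x) ss ss). Qed.

Lemma simple_fun_restrict (X : normedModType R) (E : set (measurableTypeR R))
    (s : R -> X) : measurable E -> simple_fun s ->
  simple_fun (fun r => \1_E r *: s r).
Proof.
move=> mE ss.
exact: (simple_fun_map2 (fun (a : R^o) x => a *: x) (simple_fun_indic mE) ss).
Qed.

Lemma measurable_simple_comp (X : normedModType R) (s : R -> X) (h : X -> R)
    (D : set (measurableTypeR R)) : measurable D ->
  simple_fun s -> measurable_fun D (fun r => h (s r)).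
Proof.
move=> mD [fs ms] _ B _; apply: measurableI => //.
rewrite (_ : _ @^-1` _ = \bigcup_(x in range s `&` [set x | B (h x)]) (s @^-1` [set x])).
  by apply: fin_bigcup_measurable => //; exact: finite_setIl.
apply/seteqP; split=> [r /= hr|r [x /= [_ Bx] /= rx]]; last by rewrite /= rx.
by exists (s r) => //; split => //; exists r.
Qed.

End SimpleFunctions.

Section SimpleIntegral.
Context {R : realType} {X : normedModType R}.
Notation mu := (@lebesgue_measure R).
Variables (D : set (measurableTypeR R)).
Hypotheses (mD : measurable D) (fD : (mu D < +oo)%E).

Let fDE (E : set (measurableTypeR R)) : measurable E -> mu (D `&` E) \is a fin_num.
Proof.
move=> mE; rewrite ge0_fin_numE//; apply: le_lt_trans fD.
by apply: le_measure; rewrite ?inE//; exact: measurableI.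
Qed.

(** The fibres of the pair (s, t) refine those of h(s, t); all the algebra of
    simple integrals reduces to sums over this common refinement. *)
Lemma simple_integral_comp (Y : normedModType R) (Z : normedModType R) (s : R -> Y)
    (t : R -> Z) (h : Y -> Z -> X) : simple_fun s -> simple_fun t ->
  simple_integral D (fun r => h (s r) (t r)) =
  \sum_(yz \in range s `*` range t)
    fine (mu (D `&` (s @^-1` [set yz.1] `&` t @^-1` [set yz.2]))) *: h yz.1 yz.2.
Proof.
move=> ss st; have [fs ms] := ss; have [ft mt] := st.
have [fh mh] := simple_fun_map2 h ss st.
set P := range s `*` range t; pose Q := range (fun r => h (s r) (t r)); rewrite -/Q in fh.
have fP : finite_set P by exact: finite_setX.
pose E yz := s @^-1` [set yz.1] `&` t @^-1` [set yz.2].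
have mE yz : measurable (E yz : set (measurableTypeR R)) by exact: measurableI.
transitivity (\sum_(x \in Q) \sum_(yz \in P)
    (if h yz.1 yz.2 == x then fine (mu (D `&` E yz)) *: x else 0)).
  rewrite /simple_integral; apply: eq_fsbigr => x xQ.
  have -> : D `&` (fun r => h (s r) (t r)) @^-1` [set x] =
      \bigcup_(yz in P `&` [set yz | h yz.1 yz.2 = x]) (D `&` E yz).
    apply/seteqP; split=> [r [Dr /= hr]|r [[y z] [_ /= yzx] [Dr [/= sr tr]]]]; last first.
      by split=> //=; rewrite sr tr.
    by exists (s r, t r) => //; split => //; split; exists r.
  rewrite (@measure_fin_bigcup _ _ _ mu)//; last first.
  - by move=> yz _; exact: measurableI.
  - by move=> [y z] [y' z'] _ _ [r [[_ [/= <- <-]] [_ [/= <- <-]]]].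
  - exact: finite_setIl.
  rewrite fsbig_mkcondr fsbig_finite//= (fsbig_finite _ _ fP)/=.
  rewrite -sum_fine; last first.
    by move=> yz _; case: ifP => // _; exact: fDE.
  rewrite scaler_suml; apply: eq_bigr => yz _.
  rewrite (_ : (yz \in _) = (h yz.1 yz.2 == x)); first by case: ifP => // _; rewrite scale0r.
  by apply/idP/idP => [/set_mem/= ->//|/eqP hx]; exact/mem_set.
rewrite exchange_fsbig//; apply: eq_fsbigr => -[y z] /set_mem[/= [r _ rs] [r' _ rt]].
have [/eqP E0|/set0P[r0 [Er0 Er0']]] := eqVneq (E (y, z)) set0.
  rewrite /E/= in E0; rewrite /E/= (eqP E0) setI0 measure0 scale0r.
  by apply: fsbig1 => x _; rewrite scale0r if_same.
rewrite (fsbigD1 (h y z))//=; last by exists r0 => //; rewrite Er0 Er0'.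
rewrite eqxx fsbig1 ?addr0// => x [_ /eqP xh].
by rewrite eq_sym (negbTE xh).
Qed.

Lemma simple_integralD (s t : R -> X) : simple_fun s -> simple_fun t ->
  simple_integral D (s \+ t) = simple_integral D s + simple_integral D t.
Proof.
move=> ss st; have [fs ms] := ss; have [ft mt] := st.
rewrite (@simple_integral_comp _ _ s t (fun x y => x + y))//.
rewrite (@simple_integral_comp _ _ s t (fun x _ => x))//.
rewrite (@simple_integral_comp _ _ s t (fun _ y => y))//.
rewrite -fsbig_split; last exact: finite_setX.
by apply: eq_fsbigr => yz _; rewrite scalerDr.
Qed.

Lemma simple_integralZ (c : R) (s : R -> X) : simple_fun s ->
  simple_integral D (fun t => c *: s t) = c *: simple_integral D s.
Proof.
move=> ss; have [fs ms] := ss.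
rewrite (@simple_integral_comp _ _ s s (fun x _ => c *: x))//.
rewrite (@simple_integral_comp _ _ s s (fun x _ => x))//.
rewrite !fsbig_finite//=; [|exact: finite_setX..].
by rewrite scaler_sumr; apply: eq_bigr => x _; rewrite !scalerA mulrC.
Qed.

Lemma norm_simple_integral (s : R -> X) : simple_fun s ->
  (`|simple_integral D s|%:E <= \int[mu]_(t in D) (`|s t|)%:E)%E.
Proof.
move=> ss; have [fs ms] := ss.
have -> : (\int[mu]_(t in D) (`|s t|)%:E =
    \sum_(x \in range s) (fine (mu (D `&` s @^-1` [set x])) * `|x|)%:E)%E.
  transitivity (\int[mu]_(t in D)
      (\sum_(x \in range s) (`|x| * \1_(s @^-1` [set x]) t)%:E))%E.
    apply: eq_integral => t _.
    rewrite (fsbigD1 (s t))//=; last by exists t.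
    rewrite indicE mem_set// mulr1 fsbig1 ?adde0// => x [_ /= xst].
    by rewrite indicE memNset ?mulr0//= => /esym.
  rewrite ge0_integral_fsum//.
  - apply: eq_fsbigr => x _; under eq_integral do rewrite EFinM.
    rewrite ge0_integralZl_EFin//.
    + rewrite integral_indic// setIC muleC EFinM fineK//; exact: fDE.
    + by apply/measurable_EFinP; exact: measurable_indic.
  - move=> x; apply/measurable_EFinP; apply: measurable_funM => //.
rewrite /simple_integral fsumEFin// lee_fin !fsbig_finite//=.
apply: le_trans (ler_norm_sum _ _ _) _; apply: ler_sum => x _.
by rewrite normrZ ger0_norm// fine_ge0.
Qed.

Lemma simple_integral_setD (E : set (measurableTypeR R)) (s : R -> X) :
  measurable E -> E `<=` D -> simple_fun s ->
  simple_integral D s = simple_integral E s + simple_integral (D `\` E) s.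
Proof.
move=> mE ED [fs ms]; rewrite /simple_integral !fsbig_finite//= -big_split/=.
apply: eq_bigr => x _; rewrite -scalerDl -fineD; last 2 first.
- by rewrite -(setIidr ED) -setIA; apply: fDE; exact: measurableI.
- by rewrite setDE -setIA; apply: fDE; apply: measurableI => //; exact: measurableC.
congr (fine _ *: _); rewrite -measureU//.
- by rewrite -setIUl setDUK.
- exact: measurableI.
- by apply: measurableI => //; exact: measurableD.
- by rewrite setIACA setDIK set0I.
Qed.

Lemma simple_integral_cst (x : X) : simple_integral D (cst x) = fine (mu D) *: x.
Proof.
rewrite /simple_integral (_ : range (cst x) = [set x]).
  by rewrite fsbig_set1 (_ : _ @^-1` _ = setT) ?setIT//; apply/seteqP.
by apply/seteqP; split=> [y [r _ <-]//|y ->]; exists (0 : R).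
Qed.

End SimpleIntegral.

(** * Strongly measurable functions *)

Section AlmostEverywhere.
Context {R : realType}.
Notation mu := (@lebesgue_measure R).

Lemma ae_imp (P Q : R -> Prop) : (forall t, P t -> Q t) ->
  {ae mu, forall t, P t} -> {ae mu, forall t, Q t}.
Proof. by move=> PQ; apply: (@filterS _ _ (ae_filter_ringOfSetsType mu)). Qed.

Lemma ae_imp2 (P Q S : R -> Prop) : (forall t, P t -> Q t -> S t) ->
  {ae mu, forall t, P t} -> {ae mu, forall t, Q t} -> {ae mu, forall t, S t}.
Proof. by move=> PQS; apply: (@filterS2 _ _ (ae_filter_ringOfSetsType mu)). Qed.

End AlmostEverywhere.

Section StronglyMeasurable.
Context {R : realType}.
Notation mu := (@lebesgue_measure R).
Implicit Types (D E : set (measurableTypeR R)).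

Lemma strongly_measurable_map2 (X Y Z : normedModType R) (h : X -> Y -> Z)
    D (f : R -> X) (g : R -> Y) :
  (forall (x_ : nat -> X) (y_ : nat -> Y) x y,
     x_ n @[n --> \oo] --> x -> y_ n @[n --> \oo] --> y ->
     h (x_ n) (y_ n) @[n --> \oo] --> h x y) ->
  strongly_measurable D f -> strongly_measurable D g ->
  strongly_measurable D (fun t => h (f t) (g t)).
Proof.
move=> hc [s [ss sf]] [r [sr rg]]; exists (fun n t => h (s n t) (r n t)); split.
  by move=> n; exact: simple_fun_map2.
by move=> t Dt; apply: hc; [exact: sf|exact: rg].
Qed.

Lemma strongly_measurableD (X : normedModType R) D (f g : R -> X) :
  strongly_measurable D f -> strongly_measurable D g ->
  strongly_measurable D (fun t => f t + g t).
Proof. by apply: strongly_measurable_map2 => *; exact: cvgD. Qed.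

Lemma strongly_measurableZ (X : normedModType R) D (psi : R -> R^o) (f : R -> X) :
  strongly_measurable D psi -> strongly_measurable D f ->
  strongly_measurable D (fun t => psi t *: f t).
Proof.
apply: (strongly_measurable_map2 (h := fun (a : R^o) x => a *: x)) => *.
exact: cvgZ.
Qed.

Lemma strongly_measurable_comp (X Y : normedModType R) D (h : X -> Y) (f : R -> X) :
  continuous h -> strongly_measurable D f -> strongly_measurable D (h \o f).
Proof.
move=> hc mf; apply: (strongly_measurable_map2 (h := fun x (_ : X) => h x) _ mf mf).
by move=> x_ y_ x y xx _; apply: continuous_cvg => //; exact: hc.
Qed.

Lemma strongly_measurable_cst (X : normedModType R) D (x : X) :
  strongly_measurable D (fun=> x).
Proof.
exists (fun _ => cst x); split=> [n|t Dt]; first exact: simple_fun_cst.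
exact: cvg_cst.
Qed.

Lemma strongly_measurableZl (X : normedModType R) D (c : R) (f : R -> X) :
  strongly_measurable D f -> strongly_measurable D (fun t => c *: f t).
Proof. exact: (strongly_measurableZ (@strongly_measurable_cst (R^o) D c)). Qed.

Lemma strongly_measurableB (X : normedModType R) D (f g : R -> X) :
  strongly_measurable D f -> strongly_measurable D g ->
  strongly_measurable D (fun t => f t - g t).
Proof.
by apply: (strongly_measurable_map2 (h := fun x y : X => x - y)) => *; exact: cvgB.
Qed.

Lemma strongly_measurable_simple (X : normedModType R) D (s : R -> X) :
  simple_fun s -> strongly_measurable D s.
Proof. by move=> ss; exists (fun=> s); split => // t Dt; exact: cvg_cst. Qed.

Lemma strongly_measurableS (X : normedModType R) (D D' : set R) (f : R -> X) :
  D' `<=` D -> strongly_measurable D f -> strongly_measurable D' f.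
Proof.
by move=> D'D [s [ss sf]]; exists s; split => // t D't; apply: sf; exact: D'D.
Qed.

Lemma eq_strongly_measurable (X : normedModType R) D (f g : R -> X) :
  (forall t, D t -> f t = g t) -> strongly_measurable D f -> strongly_measurable D g.
Proof.
by move=> fg [s [ss sf]]; exists s; split => // t Dt; rewrite -fg//; exact: sf.
Qed.

Import HBSimple.

Lemma strongly_measurable_real D (psi : R -> R^o) :
  measurable_fun [set: measurableTypeR R] psi -> strongly_measurable D psi.
Proof.
move=> /measurable_EFinP mpsi.
have [s scvg] := approximation_sfun measurableT mpsi.
exists (fun n => s n : R -> R^o); split.
  move=> n; split.
    exact: (@fimfunP _ _ (s n : {fimfun R >-> R})).
  move=> x; rewrite -[X in measurable X]setTI.
  by apply: (measurable_funPT (s n)) => //.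
by move=> t _; have /fine_cvgP[] := scvg t I.
Qed.

Lemma measurable_norm D (X : normedModType R) (f : R -> X) : measurable D ->
  strongly_measurable D f -> measurable_fun D (fun t => `|f t|).
Proof.
move=> mD [s [ss sf]].
apply: (@measurable_fun_cvg _ _ _ D (fun n t => `|s n t|)).
- by move=> n; apply: measurable_simple_comp.
- by move=> t Dt; apply: cvg_norm; exact: sf.
Qed.

Lemma measurable_enorm D (X : normedModType R) (f : R -> X) : measurable D ->
  strongly_measurable D f -> measurable_fun D (fun t => (`|f t|)%:E).
Proof. by move=> mD mf; apply/measurable_EFinP; exact: measurable_norm. Qed.

(** The k-th simple function uses the k-th approximation on each of the first
    k pieces only, and so has finite range; a given point lies in one piece,
    which is switched on from some k onwards. *)
Lemma strongly_measurable_bigcup (X : normedModType R) (E : nat -> set (measurableTypeR R))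
    (f : R -> X) : (forall n, measurable (E n)) -> trivIset setT E ->
  (forall n, strongly_measurable (E n) f) -> strongly_measurable (\bigcup_n E n) f.
Proof.
move=> mE tE /choice[s /all_and2[ss sf]].
exists (fun k t => \sum_(n < k) \1_(E n) t *: s n k t); split.
  move=> k; suff H m : simple_fun (fun t => \sum_(n < m) \1_(E n) t *: s n k t).
    exact: H.
  elim: m => [|m IHm].
    under eq_fun do rewrite big_ord0; exact: simple_fun_cst.
  under eq_fun do rewrite big_ord_recr/=.
  apply: (simple_fun_map2 (fun x y => x + y)) => //.
  exact: simple_fun_restrict.
move=> t [m _ Emt].
have := sf m t Emt; apply: cvg_trans; apply: near_eq_cvg.
near=> k.
have mk : (m < k)%N by near: k; exact: nbhs_infty_gt.
rewrite (bigD1 (Ordinal mk))//= indicE mem_set// scale1r big1 ?addr0// => i im.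
rewrite indicE memNset ?scale0r// => Eit.
move/eqP: im; apply; apply/val_inj => /=.
by apply: (tE i m) => //; exists t.
Unshelve. all: by end_near. Qed.

End StronglyMeasurable.

(** * The Bochner integral on sets of finite measure *)

Section BochnerIntegral.
Context {R : realType}.
Notation mu := (@lebesgue_measure R).
Variable D : set (measurableTypeR R).
Hypotheses (mD : measurable D) (fD : (mu D < +oo)%E).

Lemma integral_normD (X : normedModType R) (f g : R -> X) :
  strongly_measurable D f -> strongly_measurable D g ->
  (\int[mu]_(t in D) (`|f t + g t|)%:E <=
   \int[mu]_(t in D) (`|f t|)%:E + \int[mu]_(t in D) (`|g t|)%:E)%E.
Proof.
move=> mf mg; rewrite -ge0_integralD//; [|exact: measurable_enorm..].
apply: ge0_le_integral => //.
- by apply: measurable_enorm => //; exact: strongly_measurableD.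
- by apply: emeasurable_funD; exact: measurable_enorm.
- by move=> t _; rewrite -EFinD lee_fin ler_normD.
Qed.

Lemma integrable_simple (X : normedModType R) (s : R -> X) :
  simple_fun s -> integrable_simple_fun D s.
Proof.
move=> ss; split => // x _; apply: le_lt_trans fD.
apply: le_measure; rewrite ?inE//; apply: measurableI => //.
by case: ss.
Qed.

Lemma cvg_simple_integral0 (X : normedModType R) (E : set (measurableTypeR R))
    (s : nat -> R -> X) : measurable E -> (mu E < +oo)%E ->
  (forall n, simple_fun (s n)) ->
  (\int[mu]_(t in E) (`|s n t|)%:E)%E @[n --> \oo] --> 0%E ->
  simple_integral E (s n) @[n --> \oo] --> (0 : X).
Proof.
move=> mE fE ss s0; apply/norm_cvg0P.
have : (`|simple_integral E (s n)|%:E)%E @[n --> \oo] --> 0%E.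
  apply: (squeeze_cvge _ (cvg_cst _) s0); apply: nearW => n.
  by rewrite lee_fin normr_ge0/= norm_simple_integral.
by move/fine_cvgP => [].
Qed.

Lemma bochner_integralD (X : normedModType R) (f g : R -> X) v w :
  has_bochner_integral D f v -> has_bochner_integral D g w ->
  has_bochner_integral D (fun t => f t + g t) (v + w).
Proof.
move=> [mf [s [ss sf sv]]] [mg [r [rs rg rw]]].
have ss' n : simple_fun (s n) by have [] := ss n.
have rs' n : simple_fun (r n) by have [] := rs n.
split; first exact: strongly_measurableD.
exists (fun n => s n \+ r n); split.
- by move=> n; apply: integrable_simple; exact: (simple_fun_map2 (fun x y => x + y)).
- apply: (@squeeze_cvge _ _ _ _ (cst 0%E) _ (fun n =>
    \int[mu]_(t in D) (`|f t - s n t|)%:E + \int[mu]_(t in D) (`|g t - r n t|)%:E)%E).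
  + apply: nearW => n; rewrite integral_ge0//=.
    under eq_integral do rewrite opprD addrACA.
    by apply: integral_normD; apply: strongly_measurableB => //;
      exact: strongly_measurable_simple.
  + exact: cvg_cst.
  + by rewrite -[X in _ --> X]adde0; apply: cvgeD.
- under eq_fun do rewrite simple_integralD//.
  exact: cvgD.
Qed.

Lemma bochner_integralZ (X : normedModType R) (f : R -> X) v (c : R) :
  has_bochner_integral D f v -> has_bochner_integral D (fun t => c *: f t) (c *: v).
Proof.
move=> [mf [s [ss sf sv]]].
have ss' n : simple_fun (s n) by have [] := ss n.
split; first exact: strongly_measurableZl.
exists (fun n t => c *: s n t); split.
- by move=> n; apply: integrable_simple; exact: (simple_fun_map (fun x => c *: x)).
- rewrite (_ : (fun n => _) = fun n =>
      (`|c|%:E * \int[mu]_(t in D) (`|f t - s n t|)%:E)%E); last first.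
    apply/funext => n; under eq_integral do rewrite -scalerBr normrZ EFinM.
    rewrite ge0_integralZl_EFin//.
    apply: measurable_enorm => //; apply: strongly_measurableB => //.
    exact: strongly_measurable_simple.
  by rewrite -(mule0 `|c|%:E); apply: cvgeZl.
- under eq_fun do rewrite simple_integralZ//.
  exact: cvgZl_tmp.
Qed.

Lemma bochner_integralB (X : normedModType R) (f g : R -> X) v w :
  has_bochner_integral D f v -> has_bochner_integral D g w ->
  has_bochner_integral D (fun t => f t - g t) (v - w).
Proof.
move=> fv gw; have := bochner_integralD fv (bochner_integralZ (-1) gw).
rewrite scaleN1r; congr has_bochner_integral.
by apply/funext => t; rewrite scaleN1r.
Qed.

Lemma bochner_integral_cst (X : normedModType R) (x : X) :
  has_bochner_integral D (fun=> x) (fine (mu D) *: x).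
Proof.
split; first exact: strongly_measurable_cst.
exists (fun=> cst x); split.
- by move=> _; apply: integrable_simple; exact: simple_fun_cst.
- under eq_fun do under eq_integral do rewrite subrr normr0.
  under eq_fun do rewrite integral0.
  exact: cvg_cst.
- under eq_fun do rewrite simple_integral_cst//.
  exact: cvg_cst.
Qed.

Lemma norm_bochner_integral (X : normedModType R) (f : R -> X) v :
  has_bochner_integral D f v ->
  (`|v|%:E <= \int[mu]_(t in D) (`|f t|)%:E)%E.
Proof.
move=> [mf [s [ss sf sv]]].
have ss' n : simple_fun (s n) by have [] := ss n.
have mfs n : strongly_measurable D (fun t => f t - s n t).
  by apply: strongly_measurableB => //; exact: strongly_measurable_simple.
have H n : (`|simple_integral D (s n)|%:E <= \int[mu]_(t in D) (`|f t|)%:E +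
    \int[mu]_(t in D) (`|f t - s n t|)%:E)%E.
  apply: le_trans (norm_simple_integral mD fD (ss' n)) _.
  under [X in (_ <= _ + X)%E]eq_integral do rewrite distrC.
  apply: le_trans (integral_normD mf _); last first.
    by apply: strongly_measurableB => //; exact: strongly_measurable_simple.
  by under [leRHS]eq_integral do rewrite addrC subrK.
have nv : (`|simple_integral D (s n)|%:E)%E @[n --> \oo] --> `|v|%:E.
  by apply: cvg_EFin; [exact: nearW|exact: cvg_norm].
have [ffin|] := boolP ((\int[mu]_(t in D) (`|f t|)%:E)%E \is a fin_num); last first.
  by rewrite ge0_fin_numE ?integral_ge0// -leNgt leye_eq => /eqP ->; rewrite leey.
have : (\int[mu]_(t in D) (`|f t|)%:E +
    \int[mu]_(t in D) (`|f t - s n t|)%:E)%E @[n --> \oo] -->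
    (\int[mu]_(t in D) (`|f t|)%:E + 0)%E.
  by apply: cvgeD => //; [rewrite fin_num_adde_defl|exact: cvg_cst].
rewrite adde0 => nf.
apply: (lee_cvg_to nv nf); exact: nearW.
Qed.

Lemma bochner_integral_unique (X : normedModType R) (f : R -> X) v w :
  has_bochner_integral D f v -> has_bochner_integral D f w -> v = w.
Proof.
move=> fv fw; have := norm_bochner_integral (bochner_integralB fv fw).
under eq_integral do rewrite subrr normr0.
by rewrite integral0 lee_fin normr_le0 subr_eq0 => /eqP.
Qed.

Lemma ae_eq_bochner_integral (X : normedModType R) (f g : R -> X) v :
  strongly_measurable D g -> ae_eq_on D f g ->
  has_bochner_integral D f v -> has_bochner_integral D g v.
Proof.
move=> mg fg [mf [s [ss sf sv]]]; split => //; exists s; split => //.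
rewrite [X in X @ _](_ : _ = fun n => \int[mu]_(t in D) (`|f t - s n t|)%:E)%E//.
apply/funext => n; have [ssn _] := ss n.
have msn := strongly_measurable_simple D ssn.
apply: ge0_ae_eq_integral => //.
- by apply: measurable_enorm => //; exact: strongly_measurableB.
- by apply: measurable_enorm => //; exact: strongly_measurableB.
- by apply: ae_imp fg => t fg Dt; rewrite fg.
Qed.

(** The pointwise approximations s_n need not converge in the mean, but they do
    once they are set to zero where |s_n| > |f| + 1: this truncation does not
    affect the pointwise limit and gives an integrable dominating function. *)
Lemma ex_bochner_integral (X : completeNormedModType R) (f : R -> X) :
  strongly_measurable D f -> (\int[mu]_(t in D) (`|f t|)%:E < +oo)%E ->
  exists v, has_bochner_integral D f v.
Proof.
move=> mf foo; have [s [ss sf]] := mf.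
pose E n : set (measurableTypeR R) := D `&` [set t | `|s n t| <= `|f t| + 1].
have mE n : measurable (E n).
  rewrite /E (_ : [set t | _] = (fun t => `|f t| + 1 - `|s n t|) @^-1` `[0, +oo[).
    have : measurable_fun D (fun t => `|f t| + 1 - `|s n t|).
      apply: measurable_funB; first by apply: measurable_funD => //; exact: measurable_norm.
      by apply: measurable_norm => //; exact: strongly_measurable_simple.
    by apply => //; exact: measurable_itv.
  by apply/seteqP; split => t /=; rewrite in_itv/= andbT subr_ge0.
(* Near every t of D the truncation is eventually inactive. *)
pose r n t := \1_(E n) t *: s n t.
have sr n : simple_fun (r n) by exact: simple_fun_restrict.
have rf t : D t -> r n t @[n --> \oo] --> f t.
  move=> Dt; have := sf t Dt; apply: cvg_trans; apply: near_eq_cvg.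
  have : \forall n \near \oo, `|f t - s n t| < 1.
    by have /cvgrPdist_lt := sf t Dt; apply.
  apply: filterS => n fsn; rewrite /r indicE mem_set ?scale1r//.
  split => //=; rewrite -lerBlDl; apply: le_trans (ltW fsn).
  by rewrite distrC; exact: lerB_dist.
have rb n t : D t -> `|r n t| <= `|f t| + 1.
  move=> Dt; rewrite /r indicE; have [/set_mem[_ //=]|_] := boolP (t \in E n).
    by rewrite scale1r.
  by rewrite scale0r normr0 addr_ge0.
have intg : mu.-integrable D (fun t => (2 * `|f t| + 1)%:E).
  apply/integrableP; split.
    apply/measurable_EFinP; apply: measurable_funD => //; apply: measurable_funM => //.
    exact: measurable_norm.
  under eq_integral do rewrite gee0_abs ?lee_fin ?addr_ge0 ?mulr_ge0// EFinD EFinM.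
  rewrite ge0_integralD//=; last by apply: measurable_funeM; exact: measurable_enorm.
  have -> : (\int[mu]_(t in D) 1 = mu D)%E by rewrite integral_cst// mul1e.
  rewrite lte_add_pinfty//.
  by rewrite ge0_integralZl_EFin//; [rewrite lte_mul_pinfty|exact: measurable_enorm].
have mfr n : strongly_measurable D (fun t => f t - r n t).
  by apply: strongly_measurableB => //; exact: strongly_measurable_simple.
have fr0 : (\int[mu]_(t in D) (`|f t - r n t|)%:E)%E @[n --> \oo] --> 0%E.
  have [||||_ _] := @dominated_convergence _ _ _ mu D mD
    (fun n t => (`|f t - r n t|)%:E) (cst 0%E) (fun t => (2 * `|f t| + 1)%:E) _ _ _ intg _.
  - by move=> n; exact: measurable_enorm.
  - exact: measurable_cst.
  - apply: aeW => t Dt; apply: cvg_EFin; first exact: nearW.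
    apply/norm_cvg0P.
    rewrite -(subrr (f t)); apply: cvgB; [exact: cvg_cst|exact: rf].
  - apply: aeW => t n Dt; rewrite gee0_abs// lee_fin.
    apply: le_trans (ler_normB _ _) _; have := rb n t Dt; lra.
  - by rewrite integral0.
have : cauchy (simple_integral D (r n) @[n --> \oo]).
  apply/cauchy_ballP => e e0.
  have e20 : 0 < e / 2 by rewrite divr_gt0.
  have : \forall n \near \oo, (\int[mu]_(t in D) (`|f t - r n t|)%:E < (e / 2)%:E)%E.
    move: fr0 => /fine_cvgP[fin /cvgr0Pnorm_lt/(_ _ e20) H].
    near=> n; have fn : (\int[mu]_(t in D) (`|f t - r n t|)%:E)%E \is a fin_num.
      by near: n; exact: fin.
    rewrite -(fineK fn) lte_fin; apply: le_lt_trans (ler_norm _) _.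
    by near: n; exact: H.
  move=> H; exists ((fun n => simple_integral D (r n)) @` [set n |
    (\int[mu]_(t in D) (`|f t - r n t|)%:E < (e / 2)%:E)%E], 
   (fun n => simple_integral D (r n)) @` [set n |
    (\int[mu]_(t in D) (`|f t - r n t|)%:E < (e / 2)%:E)%E]).
    by split; apply: filterS H => n Hn; exists n.
  move=> [_ _] [/= [n nH <-] [m mH <-]].
  rewrite -ball_normE/= -scaleN1r -simple_integralZ// -simple_integralD//; last first.
    exact: (simple_fun_map (fun x => -1 *: x)).
  rewrite -lte_fin; apply: le_lt_trans (norm_simple_integral mD fD _) _.
    apply: (simple_fun_map2 (fun x y => x + y)) => //.
    exact: (simple_fun_map (fun x => -1 *: x)).
  rewrite (splitr e) EFinD; apply: le_lt_trans (lteD mH nH).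
  under [X in (_ <= _ + X)%E]eq_integral do rewrite distrC.
  apply: le_trans (integral_normD _ _); last 2 first.
  - exact: mfr.
  - by apply: strongly_measurableB => //; exact: strongly_measurable_simple.
  rewrite le_eqVlt; apply/orP; left; apply/eqP; apply: eq_integral => t _ /=.
  by rewrite scaleN1r [in RHS]addrC addrA subrK.
move/cauchy_cvgP/cvg_ex => [v rv]; exists v; split => //; exists r; split => //.
by move=> n; exact: integrable_simple.
Unshelve. all: by end_near. Qed.

(** Off D' the function vanishes, so there the approximating simple functions
    are themselves the error, and their integral over D \ D' tends to zero. *)
Lemma bochner_integralS (X : normedModType R) (D' : set (measurableTypeR R))
    (f : R -> X) v : measurable D' -> D' `<=` D ->
  (forall t, D t -> ~ D' t -> f t = 0) ->
  has_bochner_integral D f v -> has_bochner_integral D' f v.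
Proof.
move=> mD' D'D f0 [mf [s [ss sf sv]]].
have ss' n : simple_fun (s n) by have [] := ss n.
have mDD' : measurable (D `\` D') by exact: measurableD.
have fDD' : (mu (D `\` D') < +oo)%E.
  by apply: le_lt_trans fD; apply: le_measure; rewrite ?inE// => t [].
have mfs n : strongly_measurable D (fun t => f t - s n t).
  by apply: strongly_measurableB => //; exact: strongly_measurable_simple.
split; first exact: strongly_measurableS mf.
exists s; split.
- move=> n; split => // x x0; apply: le_lt_trans fD.
  apply: le_measure; rewrite ?inE//; last by move=> t [/D'D].
  by apply: measurableI => //; case: (ss' n).
- apply: (squeeze_cvge _ (cvg_cst _) sf); apply: nearW => n.
  rewrite integral_ge0//= ge0_subset_integral//.
  exact: measurable_enorm.
- have r0 : simple_integral (D `\` D') (s n) @[n --> \oo] --> (0 : X).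
    apply: cvg_simple_integral0 => //.
    apply: (squeeze_cvge _ (cvg_cst _) sf); apply: nearW => n.
    rewrite integral_ge0//=; apply: (@le_trans _ _
        (\int[mu]_(t in D `\` D') (`|f t - s n t|)%:E)%E).
      rewrite le_eqVlt; apply/orP; left; apply/eqP; apply: eq_integral => t.
      by move=> /set_mem[Dt D't]; rewrite f0// sub0r normrN.
    by apply: ge0_subset_integral => //; exact: measurable_enorm.
  rewrite -[v]subr0 [X in X @ _](_ : _ = fun n =>
      simple_integral D (s n) - simple_integral (D `\` D') (s n)).
    exact: cvgB.
  by apply/funext => n; rewrite (simple_integral_setD mD fD mD')// addrK.
Qed.

End BochnerIntegral.

(** * Smooth bump functions *)

Section Smooth.
Context {R : realType}.

Definition smooth (f : R -> R) := forall n t, derivable (derive1n n f) t 1.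

(** Smoothness is proved below by exhibiting a class that contains the function
    and the derivatives of all its members. *)
Lemma smooth_family (F : (R -> R) -> Prop) :
  (forall f, F f -> exists2 g, F g & forall t : R, is_derive t 1 f (g t)) ->
  forall f, F f -> smooth f.
Proof.
move=> HF f Ff n t.
suff : F (derive1n n f) by move=> /HF[g _ dg]; have [] := dg t.
elim: n {t} => // n /HF[g Fg dg]; rewrite derive1nS.
rewrite (_ : derive1 _ = g)//; apply/funext => t.
by rewrite derive1E; apply: derive_val.
Qed.

Lemma smooth_is_derive f (t : R) : smooth f -> is_derive t 1 f (derive1 f t).
Proof. by move=> sf; rewrite derive1E; apply/derivableP; exact: (sf 0%N). Qed.

Lemma smooth_derive f : smooth f -> smooth (derive1 f).
Proof. by move=> sf n t; rewrite -derive1Sn; exact: sf. Qed.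

(** The Leibniz rule makes this class stable under differentiation. *)
Inductive smooth_sum_prod : (R -> R) -> Prop :=
| SmoothProd f g : smooth f -> smooth g -> smooth_sum_prod (fun t => f t * g t)
| SmoothSum f g : smooth_sum_prod f -> smooth_sum_prod g ->
    smooth_sum_prod (fun t => f t + g t).

Lemma smoothM f g : smooth f -> smooth g -> smooth (fun t => f t * g t).
Proof.
move=> sf sg; apply: (@smooth_family smooth_sum_prod); last exact: SmoothProd.
move=> h; elim=> {f g sf sg h} [f g sf sg|f g _ [f' Ff' df'] _ [g' Fg' dg']].
  exists (fun t => derive1 f t * g t + derive1 g t * f t).
    by apply: SmoothSum; apply: SmoothProd => //; exact: smooth_derive.
  move=> t; have df := smooth_is_derive t sf; have dg := smooth_is_derive t sg.
  rewrite [X in is_derive _ _ X](_ : _ = f * g)//.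
  by apply: is_derive_eq; rewrite addrC /GRing.scale/= [g t * _]mulrC [f t * _]mulrC.
exists (fun t => f' t + g' t); first exact: SmoothSum.
by move=> t; apply: is_deriveD.
Qed.

Lemma smooth_affine (f : R -> R) (k b : R) : smooth f ->
  smooth (fun t => f (k * t + b)).
Proof.
move=> sf; apply: (@smooth_family (fun g => exists c h, smooth h /\
    g = fun t => c * h (k * t + b))); last first.
  by exists 1, f; split => //; apply/funext => t; rewrite mul1r.
move=> _ [c [h [sh ->]]]; exists (fun t => (c * k) * derive1 h (k * t + b)).
  by exists (c * k), (derive1 h); split => //; exact: smooth_derive.
move=> t; have dk : is_derive t 1 (fun t : R => k * t + b) k.
  by apply: is_derive_eq; rewrite addr0 /GRing.scale/= mulr1.
have := @is_derive1_comp _ h (fun t => k * t + b) t _ _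
  (smooth_is_derive (k * t + b) sh) dk.
move=> /(is_deriveZ c) H; apply: (is_derive_eq H).
by rewrite /GRing.scale/= -mulrA; congr (_ * _); rewrite mulrC.
Qed.

Lemma smooth_id : smooth id.
Proof.
apply: (@smooth_family (fun f => f = id \/ exists c, f = fun=> c)); last by left.
move=> _ [->|[d ->]].
  by exists (fun=> 1); [right; exists 1|move=> t; exact: is_derive_id].
by exists (fun=> 0); [right; exists 0|move=> t; exact: is_derive_cst].
Qed.

(** The functions x^-m exp(-1/x), extended by 0 to x <= 0.  The classical flat
    function is the case m = 0; its derivatives are combinations of the others. *)
Definition flat_exp (m : nat) (x : R) : R :=
  if 0 < x then x^-1 ^+ m * expR (- x^-1) else 0.

Lemma flat_exp_ge0 m x : 0 <= flat_exp m x.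
Proof.
rewrite /flat_exp; case: ifPn => // x0.
by rewrite mulr_ge0 ?expR_ge0// exprn_ge0// invr_ge0 ltW.
Qed.

(** With y = 1/x this is y^(m+1) / (m+1)! <= exp y.  Applied to m + 1, it
    bounds the difference quotient of [flat_exp m] at 0. *)
Lemma flat_exp_le m x : flat_exp m x <= (m.+1)`!%:R * `|x|.
Proof.
rewrite /flat_exp; case: ifPn => [x0|_]; last by rewrite mulr_ge0.
have y0 : 0 <= x^-1 by rewrite invr_ge0 ltW.
have := expR_ge1Dxn m y0; rewrite (gtr0_norm x0) => H.
rewrite expRN ler_pdivrMr ?expR_gt0//.
have {H} : x^-1 ^+ m.+1 / (m.+1)`!%:R <= expR x^-1.
  by apply: le_trans H; rewrite lerDr.
rewrite ler_pdivrMr ?ltr0n ?fact_gt0// exprS => H.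
have -> : x^-1 ^+ m = x * (x^-1 * x^-1 ^+ m) by rewrite mulrA divff ?mul1r ?gt_eqF.
rewrite [leRHS](_ : _ = x * (expR x^-1 * (m.+1)`!%:R)); last by ring.
by rewrite ler_pM2l.
Qed.

Lemma is_derive_flat_exp (m : nat) (x : R) :
  is_derive x 1 (flat_exp m) (- (m%:R * flat_exp m.+1 x) + flat_exp m.+2 x).
Proof.
have [x0|x0|<-] := ltgtP 0 x.
- have dV : is_derive x 1 (fun y : R => y^-1) (- x ^- 2 *: 1).
    by apply: is_deriveV; rewrite gt_eqF.
  have dX : is_derive x 1 (fun y : R => y^-1 ^+ m * expR (- y^-1))
     (- (m%:R * flat_exp m.+1 x) + flat_exp m.+2 x).
    have dE := @is_derive1_comp _ expR (fun y => - y^-1) x _ _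
      (is_derive_expR (- x^-1)) (is_deriveN dV).
    have dP := is_deriveX m dV.
    have := is_deriveM dP dE; rewrite !fctE => H; apply: (is_derive_eq H).
    rewrite /flat_exp x0 /GRing.scale/=.
    case: m {dP H} => [|m]; rewrite /= ?expr0 ?exprS -?exprVn.
      by rewrite !mulr1 invfM; ring.
    by rewrite !mulr1 invfM; ring.
  apply: near_eq_is_derive dX; near=> y.
  by rewrite /flat_exp ifT//; near: y; exact: lt_nbhsr.
- have d0 : is_derive x 1 (fun=> 0 : R) (- (m%:R * flat_exp m.+1 x) + flat_exp m.+2 x).
    by rewrite /flat_exp ltNge ltW//= mulr0 oppr0 addr0; exact: is_derive_cst.
  apply: near_eq_is_derive d0; near=> y.
  rewrite /flat_exp ifF//; apply/negbTE; rewrite -leNgt ltW//; near: y.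
  exact: lt_nbhsl.
- have f00 k : flat_exp k 0 = 0 by rewrite /flat_exp ltxx.
  rewrite !f00 mulr0 oppr0 addr0.
  have H : h^-1 *: ((flat_exp m \o shift 0) (h *: (1 : R)) - flat_exp m 0)
      @[h --> 0^'] --> (0 : R).
    apply/cvgr0Pnorm_le => e e0; near=> h.
    rewrite f00 subr0 /= addr0 /GRing.scale/= mulr1.
    have -> : h^-1 * flat_exp m h = flat_exp m.+1 h.
      by rewrite /flat_exp; case: ifP => _; rewrite ?mulr0// exprS mulrA.
    rewrite ger0_norm ?flat_exp_ge0//; apply: le_trans (flat_exp_le _ _) _.
    rewrite mulrC -ler_pdivlMr ?ltr0n ?fact_gt0//.
    near: h; apply: dnbhs0_le.
    by rewrite divr_gt0// ltr0n fact_gt0.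
  by apply: DeriveDef; [apply/cvg_ex; exists 0|apply/cvg_lim].
Unshelve. all: by end_near. Qed.

Inductive flat_exp_span : (R -> R) -> Prop :=
| FlatExp m : flat_exp_span (flat_exp m)
| FlatExpZ c f : flat_exp_span f -> flat_exp_span (fun t => c * f t)
| FlatExpD f g : flat_exp_span f -> flat_exp_span g ->
    flat_exp_span (fun t => f t + g t).

Lemma smooth_flat_exp m : smooth (flat_exp m).
Proof.
apply: (@smooth_family flat_exp_span); last exact: FlatExp.
move=> f; elim=> {m f} [m|c f _ [f' Ff' df']|f g _ [f' Ff' df'] _ [g' Fg' dg']].
- exists (fun x => (- m%:R) * flat_exp m.+1 x + flat_exp m.+2 x).
    by apply: FlatExpD; [apply: FlatExpZ|]; exact: FlatExp.
  by move=> t; rewrite mulNr; exact: is_derive_flat_exp.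
- exists (fun x => c * f' x); first exact: FlatExpZ.
  by move=> t; exact: is_deriveZ.
- exists (fun t => f' t + g' t); first exact: FlatExpD.
  by move=> t; apply: is_deriveD.
Qed.

Lemma smooth_continuous f : smooth f -> continuous f.
Proof.
by move=> sf t; apply/differentiable_continuous/derivable1_diffP; exact: (sf 0%N).
Qed.

Lemma test_functionM I (phi chi : R -> R) :
  smooth chi -> test_function I phi -> test_function I (fun t => phi t * chi t).
Proof.
move=> schi [sphi [K [cK KI K0]]]; split; first exact: smoothM.
by exists K; split => // t Kt; rewrite K0// mul0r.
Qed.

(** The products of flat functions exp(-1/(n(t - c))) exp(-1/(n(d - t))),
    which tend boundedly to the indicator of ]c, d[. *)
Lemma exists_bump (a b c d : R) : a < c -> c < d -> d < b ->
  exists phi : nat -> R -> R, (forall n, test_function `[a, b] (phi n)) /\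
    (forall n t, `|phi n t| <= 1) /\ (forall n t, ~ `]c, d[%classic t -> phi n t = 0)
    /\ forall t, `]c, d[%classic t -> phi n t @[n --> \oo] --> (1 : R).
Proof.
move=> ac cd db.
pose phi (n : nat) t := flat_exp 0 (n.+1%:R * t + (- n.+1%:R * c)) *
                flat_exp 0 (- n.+1%:R * t + n.+1%:R * d).
have E t : t <= 0 -> flat_exp 0 t = 0 by move=> t0; rewrite /flat_exp ltNge t0.
have phi0 n t : ~ `]c, d[%classic t -> phi n t = 0.
  rewrite /phi /= in_itv/= => /negP; rewrite negb_and -!leNgt => /orP[tc|dt].
    by rewrite E ?mul0r// mulNr -mulrBr mulr_ge0_le0// subr_le0.
  by rewrite [X in _ * X]E ?mulr0// mulNr addrC -mulrBr mulr_ge0_le0// subr_le0.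
have E1 t : `|flat_exp 0 t| <= 1.
  rewrite ger0_norm ?flat_exp_ge0// /flat_exp; case: ifP => // t0.
  by rewrite expr0 mul1r expR_le1 oppr_le0 invr_ge0 ltW.
have Ec (u : R) : 0 < u -> flat_exp 0 (n.+1%:R * u) @[n --> \oo] --> (1 : R).
  move=> u0.
  rewrite [X in X @ _](_ : _ = fun n => expR (- (u^-1 * n.+1%:R^-1))); last first.
    by apply/funext => n; rewrite /flat_exp ifT ?mulr_gt0// expr0 mul1r invfM mulrC.
  rewrite -[X in _ --> X](@expR0 R); apply: continuous_cvg; first exact: continuous_expR.
  rewrite -[X in _ --> X]oppr0; apply: cvgN; rewrite -[X in _ --> X](mulr0 u^-1).
  by apply: cvgM; [exact: cvg_cst|exact: cvg_harmonic].
exists phi; split; [|split; [|split]] => //.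
- move=> n; split; first by apply: smoothM; apply: smooth_affine; exact: smooth_flat_exp.
  exists `[c, d]%classic; split; [exact: segment_compact| |].
    by rewrite interior_itv => t /=; rewrite !in_itv/= => /andP[ct td]; lra.
  by move=> t tcd; apply: phi0 => tcd'; apply: tcd; exact: subset_itv_oo_cc.
- by move=> n t; rewrite normrM mulr_ile1.
- move=> t /=; rewrite in_itv/= => /andP[ct td].
  rewrite -[X in _ --> X](mulr1 1) /phi.
  under eq_fun do rewrite !mulNr -mulrBr [- _ + _]addrC -mulrBr.
  by apply: cvgM; apply: Ec; rewrite subr_gt0.
Qed.

End Smooth.

(** * Uniqueness of weak derivatives *)

Section IntervalFacts.
Context {R : realType}.
Notation mu := (@lebesgue_measure R).

Lemma interval_finite (i : interval R) (a b : R) :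
  [set` i] `<=` `[a, b]%classic -> (mu [set` i] < +oo)%E.
Proof.
move=> iab; apply: (@le_lt_trans _ _ (mu `[a, b]%classic)).
  by apply: le_measure; rewrite ?inE//; exact: measurable_itv.
rewrite lebesgue_measure_itv/=; case: ifP => _; exact: ltry.
Qed.

Lemma segment_finite (a b : R) : (mu `[a, b]%classic < +oo)%E.
Proof. exact: interval_finite (@subset_refl _ _). Qed.

Lemma ae_neq (c : R) : {ae mu, forall t : R, t <> c}.
Proof.
exists [set c]; split => //; first exact: lebesgue_measure_set1.
by move=> t /= /contrapT.
Qed.

End IntervalFacts.

Section DuBoisReymond.
Context {R : realType} {X : normedModType R}.
Notation mu := (@lebesgue_measure R).
Variables (a b : R) (w : R -> X).
Hypotheses (mw : strongly_measurable `[a, b] w)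
  (fw : (\int[mu]_(t in `[a, b]) (`|w t|)%:E < +oo)%E)
  (w0 : forall phi, test_function `[a, b] phi ->
    has_bochner_integral `[a, b] (fun t => phi t *: w t) 0).

Let mI : measurable (`[a, b]%classic : set (measurableTypeR R)).
Proof. exact: measurable_itv. Qed.

Let fI : (mu `[a, b]%classic < +oo)%E := segment_finite a b.

Let mwx (x : X) : strongly_measurable `[a, b] (fun t => w t - x).
Proof. by apply: strongly_measurableB => //; exact: strongly_measurable_cst. Qed.

Let intg (x : X) (D : set (measurableTypeR R)) : measurable D -> D `<=` `[a, b] ->
  mu.-integrable D (fun t => (`|w t| + `|x|)%:E).
Proof.
move=> mD DI; apply: (integrableS mI mD DI).
apply/integrableP; split.
  by apply/measurable_EFinP; apply: measurable_funD => //; exact: measurable_norm.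
under eq_integral do rewrite gee0_abs ?lee_fin ?addr_ge0// EFinD.
rewrite ge0_integralD//=; last exact: measurable_enorm.
rewrite integral_cst// lte_add_pinfty// lte_mul_pinfty//.
Qed.

(** Testing w with bumps that tend to the indicator of ]c, d[ shows that w has
    mean zero there; hence (d - c) x is, up to sign, the integral of w - x. *)
Lemma null_mean_lower_bound (x : X) (c d : R) : a < c -> c < d -> d < b ->
  ((d - c)%:E * `|x|%:E <= \int[mu]_(t in `]c, d[) (`|w t - x|)%:E)%E.
Proof.
move=> ac cd db; have [phi [tphi [phi1 [phi0 phic]]]] := exists_bump ac cd db.
have sub : `]c, d[%classic `<=` `[a, b]%classic.
  by move=> t /=; rewrite !in_itv/= => /andP[]; lra.
have mD : measurable (`]c, d[%classic : set (measurableTypeR R)) by exact: measurable_itv.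
have fD : (mu `]c, d[%classic < +oo)%E := interval_finite sub.
have H n : has_bochner_integral `]c, d[ (fun t => phi n t *: w t - x) (0 - (d - c) *: x).
  apply: bochner_integralB => //.
    apply: (bochner_integralS (D := `[a, b]%classic)) => //; last exact: w0.
    by move=> t _ tcd; rewrite phi0// scale0r.
  have := bochner_integral_cst mD fD x.
  by rewrite lebesgue_measure_itv/= lte_fin cd.
have mD' n : strongly_measurable `]c, d[ (fun t => phi n t *: w t - x) by have [] := H n.
have B n : ((d - c)%:E * `|x|%:E <= \int[mu]_(t in `]c, d[) (`|phi n t *: w t - x|)%:E)%E.
  have := norm_bochner_integral mD fD (H n).
  by rewrite sub0r normrN normrZ gtr0_norm ?subr_gt0.
have [||||_ _ cvgi] := @dominated_convergence _ _ _ mu _ mD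
    (fun n t => (`|phi n t *: w t - x|)%:E) (fun t => (`|w t - x|)%:E)
    (fun t => (`|w t| + `|x|)%:E) _ _ _ (intg x mD sub) _.
- by move=> n; exact: measurable_enorm.
- by apply: measurable_enorm => //; exact: strongly_measurableS (mwx x).
- apply: aeW => t Dt; apply: cvg_EFin; first exact: nearW.
  apply: cvg_norm; apply: cvgB; last exact: cvg_cst.
  rewrite -[X in _ --> X]scale1r; apply: cvgZ; [exact: phic|exact: cvg_cst].
- apply: aeW => t n Dt; rewrite gee0_abs// lee_fin.
  apply: le_trans (ler_normB _ _) _; rewrite lerD2r normrZ.
  by rewrite ler_piMl.
- by apply: (lee_cvg_to (cvg_cst _) cvgi); exact: nearW.
Qed.

(** Divide [null_mean_lower_bound] by the length of a small interval around t and
    apply Lebesgue's differentiation theorem to |w - x|. *)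
Let lebesgue_lower_bound (x : X) :
  {ae mu, forall t : R, `]a, b[%classic t -> `|x| <= `|w t - x|}.
Proof.
pose g := (fun t => `|w t - x|) \_ (`[a, b]%classic).
have lg : locally_integrable setT g.
  apply: integrable_locally_restrict => //.
  apply: le_integrable (intg x mI (@subset_refl _ _)) => //.
  - by apply: measurable_enorm.
  - move=> t _ /=; rewrite !ger0_norm ?addr_ge0// lee_fin; exact: ler_normB.
have E t : nicely_shrinking t (fun n => ball t (n.+1%:R^-1 : R)).
  split; first by move=> n; exact: measurable_ball.
  exists (1, fun n => n.+1%:R^-1%:pos); split => //=.
  - exact: cvg_harmonic.
  - by move=> n; exact: subset_refl.
  - by move=> n; rewrite mul1e.
apply: ae_imp (lebesgue_differentiation lg) => t gt /=; rewrite in_itv/= => /andP[a_t tb].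
have := nice_lebesgue_differentiation E lg gt.
rewrite {2}/g patchE mem_set; last by rewrite /= in_itv/= (ltW a_t) (ltW tb).
move=> cvgg; rewrite -lee_fin; apply: (lee_cvg_to (cvg_cst _) cvgg).
have e0 : 0 < Num.min (t - a) (b - t) by rewrite lt_min !subr_gt0 a_t.
near=> n.
have : n.+1%:R^-1 < Num.min (t - a) (b - t).
  by near: n; exact: near_infty_natSinv_lt (PosNum e0).
rewrite lt_min => /andP[n1 n2]; have n0 : 0 < n.+1%:R^-1 :> R by rewrite invr_gt0.
move: (n.+1%:R^-1 : R) n1 n2 n0 => h n1 n2 n0.
have := @null_mean_lower_bound x (t - h) (t + h).
move=> /(_ _ _ _) H; rewrite lebesgue_measure_ball; last exact: ltW.
rewrite inver gt_eqF ?mulrn_wgt0// lee_pdivlMl ?mulrn_wgt0//.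
have -> : (\int[mu]_(y in ball t h) (g y)%:E =
    \int[mu]_(y in `](t - h)%R, (t + h)%R[) (`|w y - x|)%:E)%E.
  rewrite ball_itv; apply: eq_integral => y /set_mem/=; rewrite in_itv/= => /andP[y1 y2].
  by rewrite /g patchE mem_set//= in_itv/=; lra.
apply: le_trans (H _ _ _); [|lra..].
by rewrite (_ : h *+ 2 = t + h - (t - h))// mulr2n; ring.
Unshelve. all: by end_near. Qed.

(** Take for x the values s_n(t) of the simple functions converging to w: in the
    limit |s_n(t)| <= |w(t) - s_n(t)| reads |w(t)| <= 0.  The s_n have countably
    many values altogether, so one null set serves for all of them. *)
Lemma du_bois_reymond : ae_eq_on `[a, b] w (fun=> 0).
Proof.
have [s [ss sw]] := mw.
have /choice[l rl] : forall n, exists l : seq X, range (s n) = [set` l].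
  by move=> n; apply/finite_seqP; case: (ss n).
have /ae_foralln H : forall n, {ae mu, forall t : R, forall k,
    `]a, b[%classic t -> `|nth 0 (l n) k| <= `|w t - nth 0 (l n) k|}.
  by move=> n; apply: ae_foralln => k; exact: lebesgue_lower_bound.
apply: (ae_imp2 _ H (ae_imp2 _ (ae_neq a) (ae_neq b))) => [|t ta tb]; last first.
  exact: conj ta tb.
move=> t Ht [/eqP ta /eqP tb] /[dup] It; rewrite /= in_itv/= => /andP[a_t t_b].
have ot : `]a, b[%classic t 
  by rewrite /= in_itv/= !lt_neqAle a_t t_b tb eq_sym ta.
have sn n : `|s n t| <= `|w t - s n t|.
  have : s n t \in l n by have := rl n; move=> /seteqP[+ _]; apply; exists t.
  by move=> /(nth_index 0) <-; exact: Ht.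
apply/eqP; rewrite -normr_le0.
have c1 : `|s n t| @[n --> \oo] --> `|w t| by apply: cvg_norm; exact: sw.
have c2 : `|w t - s n t| @[n --> \oo] --> `|w t - w t|.
  by apply: cvg_norm; apply: cvgB; [exact: cvg_cst|exact: sw].
rewrite -(normr0 X) -(subrr (w t)).
apply: (ler_cvg_to c1 c2); exact: nearW.
Qed.

End DuBoisReymond.

Section WeakDerivative.
Context {R : realType} {X : normedModType R}.
Notation mu := (@lebesgue_measure R).

Lemma weak_derivative_unique (a b : R) (u w1 w2 : R -> X) :
  strongly_measurable `[a, b] w1 -> strongly_measurable `[a, b] w2 ->
  (\int[mu]_(t in `[a, b]) (`|w1 t|)%:E < +oo)%E ->
  (\int[mu]_(t in `[a, b]) (`|w2 t|)%:E < +oo)%E ->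
  weak_derivative `[a, b] u w1 -> weak_derivative `[a, b] u w2 ->
  ae_eq_on `[a, b] w1 w2.
Proof.
move=> m1 m2 f1 f2 d1 d2.
have mI : measurable (`[a, b]%classic : set (measurableTypeR R)) by exact: measurable_itv.
have fI := segment_finite a b.
suff : ae_eq_on `[a, b] (fun t => w1 t - w2 t) (fun=> 0).
  by apply: ae_imp => t H /H /eqP; rewrite subr_eq0 => /eqP.
apply: du_bois_reymond.
- exact: strongly_measurableB.
- apply: le_lt_trans (lte_add_pinfty f1 f2).
  under [X in (_ <= _ + X)%E]eq_integral do rewrite -normrN -scaleN1r.
  apply: le_trans (integral_normD _ _ _) => //; last exact: strongly_measurableZl.
  by under [leRHS]eq_integral do rewrite scaleN1r.
- move=> phi tphi; have [v1 [u1 p1]] := d1 _ tphi; have [v2 [u2 p2]] := d2 _ tphi.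
  have := bochner_integralB mI fI p1 p2.
  rewrite (bochner_integral_unique mI fI u1 u2) subrr.
  by congr has_bochner_integral; apply/funext => t; rewrite scalerBr.
Qed.

End WeakDerivative.

(** * Lebesgue norms of vector-valued functions *)

Section LpNorm.
Context {R : realType}.
Notation mu := (@lebesgue_measure R).
Variable p : R.
Hypothesis p1 : 1 < p.
Implicit Types (D E : set (measurableTypeR R)) (X Y Z : normedModType R).

Let p0 : 0 < p. Proof. exact: lt_trans p1. Qed.

Local Notation restricted_norm D f := (fun t => \1_D t * `|f t|).

Lemma Lp_enormE X D (f : R -> X) :
  Lp_enorm p D f = Lnorm mu p%:E (EFin \o restricted_norm D f).
Proof.
rewrite /Lp_enorm; congr (Lnorm _ _ _); apply/funext => t.
by rewrite patchE/= indicE; case: (t \in D); rewrite ?mul1r ?mul0r.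
Qed.

Lemma measurable_restricted_norm X D (f : R -> X) : measurable D ->
  strongly_measurable D f ->
  measurable_fun [set: measurableTypeR R] (restricted_norm D f).
Proof.
move=> mD mf.
rewrite (_ : (fun t => _) = (fun t => `|f t|) \_ D).
  by apply/(measurable_restrictT _ _).1 => //; exact: measurable_norm.
by apply/funext => t; rewrite patchE indicE; case: ifP => _; rewrite ?mul1r ?mul0r.
Qed.

Lemma Lnorm_le (F G : R -> R) :
  measurable_fun [set: measurableTypeR R] F ->
  measurable_fun [set: measurableTypeR R] G ->
  {ae mu, forall t : R, `|F t| <= `|G t|} ->
  (Lnorm mu p%:E (EFin \o F) <= Lnorm mu p%:E (EFin \o G))%E.
Proof.
move=> mF mG FG; rewrite unlock; apply: gt0_ler_poweR.
- by rewrite invr_ge0 ltW.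
- by rewrite in_itv/= leey andbT integral_ge0// => t _; exact: poweR_ge0.
- by rewrite in_itv/= leey andbT integral_ge0// => t _; exact: poweR_ge0.
apply: ae_ge0_le_integral => //.
- by move=> t _; exact: poweR_ge0.
- apply: (@measurableT_comp _ _ _ _ _ _ (fun x : \bar R => x `^ p)%E).
    exact: measurable_poweR.
  by apply: measurableT_comp => //; exact/measurable_EFinP.
- by move=> t _; exact: poweR_ge0.
- apply: (@measurableT_comp _ _ _ _ _ _ (fun x : \bar R => x `^ p)%E).
    exact: measurable_poweR.
  by apply: measurableT_comp => //; exact/measurable_EFinP.
- apply: ae_imp FG => t FG _; apply: gt0_ler_poweR => //.
  + exact: ltW.
  + by rewrite in_itv/= leey lee_fin normr_ge0.
  + by rewrite in_itv/= leey lee_fin normr_ge0.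
Qed.

Lemma Lnorm_scale (F : R -> R) (K : R) :
  measurable_fun [set: measurableTypeR R] F -> 0 <= K ->
  Lnorm mu p%:E (EFin \o (fun t => K * F t)) =
  (K%:E * Lnorm mu p%:E (EFin \o F))%E.
Proof.
move=> mF K0; rewrite unlock /=.
have -> : (\int[mu]_x `|(K * F x)%:E| `^ p =
           (K `^ p)%:E * \int[mu]_x `|(F x)%:E| `^ p)%E.
  rewrite -ge0_integralZl_EFin//; last 3 first.
  - by move=> t _; exact: poweR_ge0.
  - apply: (@measurableT_comp _ _ _ _ _ _ (fun x : \bar R => x `^ p)%E).
      exact: measurable_poweR.
    by apply: measurableT_comp => //; exact/measurable_EFinP.
  - exact: powR_ge0.
  apply: eq_integral => t _.
  by rewrite !abse_EFin !poweR_EFin normrM powRM// ger0_norm// EFinM.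
rewrite poweRM ?lee_fin ?powR_ge0//; last first.
  by rewrite integral_ge0// => t _; exact: poweR_ge0.
by rewrite poweR_EFin -powRrM divff ?gt_eqF// powRr1.
Qed.

(** The three functions may live on different sets, so that both the triangle
    inequality and the splitting of an interval are instances. *)
Lemma Lp_enorm_le_add X Y Z D D1 D2 (h : R -> X) (f : R -> Y) (g : R -> Z) :
  measurable D -> measurable D1 -> measurable D2 ->
  strongly_measurable D h -> strongly_measurable D1 f -> strongly_measurable D2 g ->
  {ae mu, forall t : R, D t -> `|h t| <= \1_D1 t * `|f t| + \1_D2 t * `|g t|} ->
  (Lp_enorm p D h <= Lp_enorm p D1 f + Lp_enorm p D2 g)%E.
Proof.
move=> mD mD1 mD2 mh mf mg hfg; rewrite !Lp_enormE.
have mF := measurable_restricted_norm mD1 mf.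
have mG := measurable_restricted_norm mD2 mg.
apply: le_trans (minkowski_EFin _ mF mG (ltW p1)).
apply: Lnorm_le; first exact: measurable_restricted_norm.
  exact: measurable_funD.
apply: ae_imp hfg => t hfg; rewrite !ger0_norm ?addr_ge0 ?mulr_ge0//=.
rewrite {1}indicE; have [/set_mem Dt|_] := boolP (t \in D).
  by rewrite mul1r hfg.
by rewrite mul0r addr_ge0 ?mulr_ge0.
Qed.

Lemma Lp_enorm_le X Y D D' (f : R -> X) (g : R -> Y) (K : R) :
  measurable D -> measurable D' -> strongly_measurable D f ->
  strongly_measurable D' g -> 0 <= K -> D `<=` D' ->
  {ae mu, forall t : R, D t -> `|f t| <= K * `|g t|} ->
  (Lp_enorm p D f <= K%:E * Lp_enorm p D' g)%E.
Proof.
move=> mD mD' mf mg K0 DD' fg; rewrite !Lp_enormE.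
have mF := measurable_restricted_norm mD mf.
have mG := measurable_restricted_norm mD' mg.
rewrite -Lnorm_scale//; apply: Lnorm_le => //; first exact: measurable_funM.
apply: ae_imp fg => t fg; rewrite !ger0_norm ?mulr_ge0//.
rewrite {1}indicE; have [/set_mem Dt|_] := boolP (t \in D).
  by rewrite mul1r indicE mem_set ?mul1r; [exact: fg|exact: DD'].
by rewrite mul0r !mulr_ge0.
Qed.

Lemma Lp_enorm_ge0 X D (f : R -> X) : (0 <= Lp_enorm p D f)%E.
Proof. exact: Lnorm_ge0. Qed.

Lemma Lp_normK X D (f : R -> X) : Lp p D f -> (Lp_norm p D f)%:E = Lp_enorm p D f.
Proof. by move=> [_ f_oo]; rewrite fineK// ge0_fin_numE// Lp_enorm_ge0. Qed.

Lemma Lp_norm_ge0 X D (f : R -> X) : 0 <= Lp_norm p D f.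
Proof. by rewrite fine_ge0// Lp_enorm_ge0. Qed.

Lemma Lp_dominated X Y D D' (f : R -> X) (g : R -> Y) (K : R) :
  measurable D -> measurable D' -> strongly_measurable D f -> Lp p D' g ->
  0 <= K -> D `<=` D' -> {ae mu, forall t : R, D t -> `|f t| <= K * `|g t|} ->
  Lp p D f /\ Lp_norm p D f <= K * Lp_norm p D' g.
Proof.
move=> mD mD' mf Lg K0 DD' fg.
have := Lp_enorm_le mD mD' mf Lg.1 K0 DD' fg.
rewrite -(Lp_normK Lg) -EFinM => H.
have Lf : Lp p D f by split => //; apply: le_lt_trans H _; exact: ltry.
by split => //; rewrite -lee_fin Lp_normK.
Qed.

Lemma Lp_dominated_add X Y Z D D1 D2 (h : R -> X) (f : R -> Y) (g : R -> Z) :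
  measurable D -> measurable D1 -> measurable D2 ->
  strongly_measurable D h -> Lp p D1 f -> Lp p D2 g ->
  {ae mu, forall t : R, D t -> `|h t| <= \1_D1 t * `|f t| + \1_D2 t * `|g t|} ->
  Lp p D h /\ Lp_norm p D h <= Lp_norm p D1 f + Lp_norm p D2 g.
Proof.
move=> mD mD1 mD2 mh Lf Lg hfg.
have := Lp_enorm_le_add mD mD1 mD2 mh Lf.1 Lg.1 hfg.
rewrite -(Lp_normK Lf) -(Lp_normK Lg) -EFinD => H.
have Lh : Lp p D h by split => //; apply: le_lt_trans H _; exact: ltry.
by split => //; rewrite -lee_fin Lp_normK.
Qed.

Lemma LpD X D (f g : R -> X) : measurable D -> Lp p D f -> Lp p D g ->
  Lp p D (fun t => f t + g t) /\
  Lp_norm p D (fun t => f t + g t) <= Lp_norm p D f + Lp_norm p D g.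
Proof.
move=> mD Lf Lg; apply: Lp_dominated_add => //.
  by apply: strongly_measurableD; [case: Lf|case: Lg].
by apply: aeW => t Dt; rewrite indicE mem_set// !mul1r ler_normD.
Qed.

Lemma LpB X D (f g : R -> X) : measurable D -> Lp p D f -> Lp p D g ->
  Lp p D (fun t => f t - g t) /\
  Lp_norm p D (fun t => f t - g t) <= Lp_norm p D f + Lp_norm p D g.
Proof.
move=> mD Lf Lg; apply: Lp_dominated_add => //.
  by apply: strongly_measurableB; [case: Lf|case: Lg].
by apply: aeW => t Dt; rewrite indicE mem_set// !mul1r ler_normB.
Qed.

Lemma Lp_comp X Y D (h : {linear X -> Y}) (f : R -> X) (K : R) :
  measurable D -> continuous h -> 0 <= K -> (forall x, `|h x| <= K * `|x|) ->
  Lp p D f -> Lp p D (h \o f) /\ Lp_norm p D (h \o f) <= K * Lp_norm p D f.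
Proof.
move=> mD hc K0 hK Lf; apply: Lp_dominated => //; last by apply: aeW => t _; exact: hK.
by apply: strongly_measurable_comp => //; case: Lf.
Qed.

Lemma LpS X D D' (f : R -> X) : measurable D -> measurable D' -> D `<=` D' ->
  Lp p D' f -> Lp p D f /\ Lp_norm p D f <= Lp_norm p D' f.
Proof.
move=> mD mD' DD' Lf; rewrite -[leRHS]mul1r; apply: Lp_dominated => //.
  by apply: strongly_measurableS DD' _; case: Lf.
by apply: aeW => t _; rewrite mul1r.
Qed.

Lemma ae_eq_Lp_norm X D (f g : R -> X) : measurable D -> Lp p D f ->
  strongly_measurable D g -> ae_eq_on D f g ->
  Lp p D g /\ Lp_norm p D g = Lp_norm p D f.
Proof.
move=> mD Lf mg fg.
have [Lg le1] : Lp p D g /\ Lp_norm p D g <= 1 * Lp_norm p D f.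
  apply: Lp_dominated => //.
  by apply: ae_imp fg => t fg Dt; rewrite fg// mul1r.
split => //; apply/eqP; rewrite eq_le -{1}[Lp_norm p D f]mul1r le1/= -[leRHS]mul1r.
have [] // : Lp p D f /\ Lp_norm p D f <= 1 * Lp_norm p D g.
apply: Lp_dominated => //; first by case: Lf.
by apply: ae_imp fg => t fg Dt; rewrite fg// mul1r.
Qed.

Lemma Lp_norm_eq0 X D (f : R -> X) : measurable D -> Lp p D f ->
  Lp_norm p D f = 0 -> ae_eq_on D f (fun=> 0).
Proof.
move=> mD Lf f0; have : Lp_enorm p D f = 0%E by rewrite -Lp_normK// f0.
rewrite Lp_enormE => /Lnorm_eq0_eq0 H.
have /H/(_ _) : measurable_fun [set: measurableTypeR R] (EFin \o restricted_norm D f).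
  by apply/measurable_EFinP; apply: measurable_restricted_norm => //; case: Lf.
rewrite lte_fin => /(_ p0); apply: ae_imp => t /(_ I)/= [] + Dt.
by rewrite indicE mem_set// mul1r => /normr0_eq0.
Qed.

(** On a set of finite measure, |f| <= 1 + |f|^p. *)
Lemma Lp_integrable X D (f : R -> X) : measurable D -> (mu D < +oo)%E ->
  Lp p D f -> (\int[mu]_(t in D) (`|f t|)%:E < +oo)%E.
Proof.
move=> mD fD Lf.
have mf : measurable_fun [set: measurableTypeR R] (restricted_norm D f).
  by apply: measurable_restricted_norm => //; case: Lf.
have mfp : measurable_fun D (fun t => (`|f t| `^ p)%:E).
  apply/measurable_EFinP.
  apply: (@measurableT_comp _ _ _ _ _ _ (fun x : R => x `^ p)) => //.
  by apply: measurable_norm => //; case: Lf.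
have foo : (\int[mu]_(t in D) (`|f t| `^ p)%:E < +oo)%E.
  have := Lf.2; rewrite Lp_enormE => /(@poweR_lty _ _ p).
  rewrite poweR_Lnorm ?gt_eqF//; apply: le_lt_trans.
  rewrite [leLHS]integral_mkcond; apply: ge0_le_integral => //.
  - by move=> t _; rewrite erestrict_ge0// => ? _; rewrite lee_fin powR_ge0.
  - by apply/(measurable_restrictT _ _).1.
  - apply: (@measurableT_comp _ _ _ _ _ _ (fun x : \bar R => x `^ p)%E).
      exact: measurable_poweR.
    by apply: measurableT_comp => //; exact/measurable_EFinP.
  - move=> t _; rewrite patchE/=; case: ifPn => tD; last by rewrite lee_fin powR_ge0.
    by rewrite indicE tD mul1r normr_id.
apply: (@le_lt_trans _ _ (\int[mu]_(t in D) (1 + `|f t| `^ p)%:E)%E).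
  apply: ge0_le_integral => //.
  - by apply: measurable_enorm => //; case: Lf.
  - by under eq_fun do rewrite EFinD; apply: emeasurable_funD.
  - move=> t _; rewrite lee_fin; have [f1|f1] := leP `|f t| 1.
      by rewrite (le_trans f1)// lerDl powR_ge0.
    apply: (@le_trans _ _ (`|f t| `^ p)); last by rewrite lerDr.
    by rewrite -[leLHS]powRr1// ler_powR ?ltW.
under eq_integral do rewrite EFinD.
rewrite ge0_integralD//.
by rewrite integral_cst// mul1e lte_add_pinfty.
Qed.

End LpNorm.

(** * Traces and the calculus of weak derivatives *)

Section Continuity.
Context {R : realType}.
Notation mu := (@lebesgue_measure R).

Lemma linear_norm_bound (V W : normedModType R) (h : {linear V -> W}) :
  continuous h -> exists2 K, 0 <= K & forall x, `|h x| <= K * `|x|.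
Proof.
move=> /(_ 0)/continuous_linear_bounded/linear_boundedP hb.
near +oo_R => K; exists K => //; near: K; exact: hb.
Unshelve. all: by end_near. Qed.

Lemma ae_ex_itv (P : R -> Prop) (c d : R) : c < d -> {ae mu, forall t : R, P t} ->
  exists2 t, `]c, d[%classic t & P t.
Proof.
move=> cd [N [mN N0 PN]]; apply: contrapT => H.
have sub : `]c, d[%classic `<=` N.
  by move=> t tcd; apply: PN => /= Pt; apply: H; exists t.
have : (mu `]c, d[%classic <= mu N)%E.
  by apply: le_measure; rewrite ?inE//; exact: measurable_itv.
by rewrite N0 lebesgue_measure_itv/= lte_fin cd lee_fin leNgt subr_gt0 cd.
Qed.

(** An exceptional null set cannot contain a left neighbourhood of c. *)
Lemma ae_eq_within_continuous (X : normedModType R) (v : R -> X) (a c b : R) :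
  a < c -> c <= b -> {within `[a, b], continuous v} ->
  ae_eq_on `[a, c] v (fun=> 0) -> v c = 0.
Proof.
move=> ac cb cv v0.
have {}cv : {within `[a, c], continuous v}.
  apply: continuous_subspaceW cv => t /=; rewrite !in_itv/= => /andP[-> tc].
  exact: le_trans tc cb.
have [_ _ cvc] := (continuous_within_itvP v ac).1 cv.
apply: contrapT => /eqP; rewrite -normr_gt0 => vc.
have /cvgrPdist_lt/(_ _ vc) [e /= e0 H] := cvc.
have ml : Num.max a (c - e) < c by rewrite gt_max ac ltrBlDr ltrDl.
have [t /=] := ae_ex_itv ml v0.
rewrite in_itv/= gt_max => /andP[/andP[a_t et] tc] vt.
have te : `|c - t| < e by rewrite gtr0_norm ?subr_gt0//; lra.
have := H t te tc; rewrite vt ?subr0 ?ltxx//.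
by rewrite /= in_itv/= !ltW.
Qed.

Lemma within_continuousB (X : normedModType R) (D : set R) (v w : R -> X) :
  {within D, continuous v} -> {within D, continuous w} ->
  {within D, continuous (fun t => v t - w t)}.
Proof. by move=> cv cw t; apply: cvgB; [exact: cv|exact: cw]. Qed.

Lemma within_continuousZ (X : normedModType R) (D : set R) (k : R -> R) (v : R -> X) :
  continuous k -> {within D, continuous v} ->
  {within D, continuous (fun t => k t *: v t)}.
Proof.
move=> ck cv t; apply: cvgZ; last exact: cv.
by apply: (@continuous_subspaceT _ _ D k ck t).
Qed.

Lemma trace_atB (X : normedModType R) (D : set R) (u1 u2 : R -> X) a x1 x2 :
  trace_at D u1 a x1 -> trace_at D u2 a x2 ->
  trace_at D (fun t => u1 t - u2 t) a (x1 - x2).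
Proof.
move=> [v1 [c1 e1 <-]] [v2 [c2 e2 <-]]; exists (fun t => v1 t - v2 t); split => //.
  exact: within_continuousB.
by apply: ae_imp2 e1 e2 => t e1 e2 Dt; rewrite e1// e2.
Qed.

Lemma trace_atZ (X : normedModType R) (D : set R) (k : R -> R) (u : R -> X) a x :
  continuous k -> trace_at D u a x ->
  trace_at D (fun t => k t *: u t) a (k a *: x).
Proof.
move=> ck [v [c e <-]]; exists (fun t => k t *: v t); split => //.
  exact: within_continuousZ.
by apply: ae_imp e => t e Dt; rewrite e.
Qed.

Lemma trace_atS (X : normedModType R) (D D' : set R) (u : R -> X) a x :
  D' `<=` D -> trace_at D u a x -> trace_at D' u a x.
Proof.
move=> DD' [v [c e <-]]; exists v; split => //; first exact: continuous_subspaceW c.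
by apply: ae_imp e => t e Dt; apply: e; exact: DD'.
Qed.

(** A solution that is still at rest at time c may be restarted there from 0. *)
Lemma trace_at_vanishing (X : normedModType R) (a c b : R) (u : R -> X) x0 :
  a < c -> c <= b -> trace_at `[a, b] u a x0 ->
  ae_eq_on `[a, c] u (fun=> 0) -> trace_at `[c, b] u c 0.
Proof.
move=> ac cb [v [cv vu _]] u0; exists v; split.
- apply: continuous_subspaceW cv => t /=; rewrite !in_itv/= => /andP[ct ->].
  by rewrite (le_trans (ltW ac) ct).
- apply: ae_imp vu => t vu tcb; apply: vu; move: tcb => /=; rewrite !in_itv/=.
  by move=> /andP[ct ->]; rewrite (le_trans (ltW ac) ct).
- apply: (ae_eq_within_continuous ac cb cv).
  apply: ae_imp2 vu u0 => t vu u0 tac; rewrite vu ?u0//.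
  by move: tac; rewrite /= !in_itv/= => /andP[-> tc]; exact: le_trans tc cb.
Qed.

End Continuity.

Section WeakDerivativeCalculus.
Context {R : realType}.
Notation mu := (@lebesgue_measure R).
Implicit Type X : normedModType R.

Lemma smooth_strongly_measurable (D : set (measurableTypeR R)) (f : R -> R) :
  smooth f -> strongly_measurable D (f : R -> R^o).
Proof.
move=> sf; apply: strongly_measurable_real.
by apply: continuous_measurable_fun; exact: smooth_continuous.
Qed.

Lemma test_function_out (I : set R) (phi : R -> R) t :
  closed I -> test_function I phi -> ~ I t -> phi t = 0 /\ derive1 phi t = 0.
Proof.
move=> cI [sphi [K [cK KI K0]]] It.
have I0 s : ~ I s -> phi s = 0 by move=> Is; apply: K0 => /KI/interior_subset.
split; first exact: I0.
rewrite derive1E; have d0 : is_derive t (1 : R) (cst 0 : R -> R) 0.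
  exact: is_derive_cst.
suff /@derive_val : is_derive t (1 : R) phi 0 by [].
apply: near_eq_is_derive d0.
have : nbhs t (~` I) by apply: open_nbhs_nbhs; split => //; exact: closed_openC.
by apply: filterS => s Is; rewrite I0.
Qed.

Lemma ae_eq_weak_derivative X (I : set (measurableTypeR R)) (u w w' : R -> X) :
  measurable I -> (mu I < +oo)%E -> strongly_measurable I w' -> ae_eq_on I w w' ->
  weak_derivative I u w -> weak_derivative I u w'.
Proof.
move=> mI fI mw' ww' uw phi tphi; have [v [uv wv]] := uw _ tphi.
exists v; split => //; apply: ae_eq_bochner_integral wv => //.
  apply: strongly_measurableZ => //; apply: smooth_strongly_measurable.
  by case: tphi.
by apply: ae_imp ww' => t ww' It; rewrite ww'.
Qed.

Lemma weak_derivativeS X (a b c d : R) (u w : R -> X) :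
  `[c, d]%classic `<=` `[a, b]%classic ->
  weak_derivative `[a, b] u w -> weak_derivative `[c, d] u w.
Proof.
move=> sub uw phi tphi.
have tphi' : test_function `[a, b] phi.
  have [sphi [K [cK KI K0]]] := tphi; split => //; exists K; split => //.
  by apply: subset_trans KI _; exact: interiorS.
have [v [uv wv]] := uw _ tphi'.
have mI : measurable (`[a, b]%classic : set (measurableTypeR R)) by exact: measurable_itv.
have mJ : measurable (`[c, d]%classic : set (measurableTypeR R)) by exact: measurable_itv.
have cJ : closed `[c, d]%classic by exact: itv_closed.
exists v; split.
- apply: (bochner_integralS mI (segment_finite a b)) uv => // t _ tcd.
  by have [_ ->] := test_function_out cJ tphi tcd; rewrite scale0r.
- apply: (bochner_integralS mI (segment_finite a b)) wv => // t _ tcd.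
  by have [-> _] := test_function_out cJ tphi tcd; rewrite scale0r.
Qed.

Lemma weak_derivativeB X (I : set (measurableTypeR R)) (u1 u2 w1 w2 : R -> X) :
  measurable I -> (mu I < +oo)%E ->
  weak_derivative I u1 w1 -> weak_derivative I u2 w2 ->
  weak_derivative I (fun t => u1 t - u2 t) (fun t => w1 t - w2 t).
Proof.
move=> mI fI d1 d2 phi tphi.
have [v1 [u1v wv1]] := d1 _ tphi; have [v2 [u2v wv2]] := d2 _ tphi.
exists (v1 - v2); split.
  have := bochner_integralB mI fI u1v u2v; congr has_bochner_integral.
  by apply/funext => t; rewrite scalerBr.
have := bochner_integralB mI fI wv1 wv2; rewrite opprB opprK addrC.
by congr has_bochner_integral; apply/funext => t; rewrite scalerBr.
Qed.

Lemma weak_derivativeZ X (I : set (measurableTypeR R)) (u w : R -> X) (k : R) :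
  measurable I -> (mu I < +oo)%E -> weak_derivative I u w ->
  weak_derivative I (fun t => k *: u t) (fun t => k *: w t).
Proof.
move=> mI fI d phi tphi; have [v [uv wv]] := d _ tphi; exists (k *: v); split.
  have := bochner_integralZ mI fI k uv; congr has_bochner_integral.
  by apply/funext => t; rewrite !scalerA mulrC.
have := bochner_integralZ mI fI k wv; rewrite scalerN.
by congr has_bochner_integral; apply/funext => t; rewrite !scalerA mulrC.
Qed.

(** For a test function phi, the product of phi and the affine factor is again
    a test function; its derivative produces the additional term phi k u, whose
    integral has to be split off, hence has to exist. *)
Lemma weak_derivative_affineM (X : completeNormedModType R) (a b : R) (u w : R -> X) (k m : R) :
  strongly_measurable `[a, b] u -> (\int[mu]_(t in `[a, b]) (`|u t|)%:E < +oo)%E ->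
  weak_derivative `[a, b] u w ->
  weak_derivative `[a, b] (fun t => (k * t + m) *: u t)
    (fun t => k *: u t + (k * t + m) *: w t).
Proof.
move=> mu_ fu d phi tphi.
have mI : measurable (`[a, b]%classic : set (measurableTypeR R)) by exact: measurable_itv.
have fI := segment_finite a b.
have schi : smooth (fun t : R => k * t + m).
  exact: (@smooth_affine _ id k m (@smooth_id R)).
have [v [uv wv]] := d _ (test_functionM schi tphi).
have [sphi [K [cK KI K0]]] := tphi.
have mphiu : strongly_measurable `[a, b] (fun t => phi t *: u t).
  by apply: strongly_measurableZ => //; exact: smooth_strongly_measurable.
(* A test function is bounded on [a, b], so phi u is integrable. *)
have [M M0 HM] : exists2 M, 0 <= M & forall t, `[a, b]%classic t -> `|phi t| <= M.
  have cphi : {within `[a, b], continuous phi}.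
    by apply: continuous_subspaceT; exact: smooth_continuous.
  have cI : compact (`[a, b]%classic : set R) by exact: segment_compact.
  have [M [Mr HM]] := compact_bounded (continuous_compact cphi cI).
  exists (`|M| + 1) => // t It; apply: HM; last by exists t.
  by apply: le_lt_trans (ler_norm _) _; rewrite ltrDl.
have fphiu : (\int[mu]_(t in `[a, b]) (`|phi t *: u t|)%:E < +oo)%E.
  apply: (@le_lt_trans _ _ (\int[mu]_(t in `[a, b]) (M%:E * (`|u t|)%:E))%E).
    apply: ge0_le_integral => //.
    - exact: measurable_enorm.
    - by apply: measurable_funeM; exact: measurable_enorm.
    - by move=> t It; rewrite -EFinM lee_fin normrZ ler_wpM2r// HM.
  rewrite ge0_integralZl_EFin//; first by rewrite lte_mul_pinfty.
  exact: measurable_enorm.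
have [z hz] := ex_bochner_integral mI fI mphiu fphiu.
have hkz := bochner_integralZ mI fI k hz.
have dchi t : is_derive t (1 : R) (fun t : R => k * t + m) k.
  by apply: is_derive_eq; rewrite addr0 /GRing.scale/= mulr1.
have dprod t : derive1 (fun t => phi t * (k * t + m)) t =
    derive1 phi t * (k * t + m) + phi t * k.
  rewrite derive1E.
  have H := is_deriveM (smooth_is_derive t sphi) (dchi t).
  rewrite (@derive_val _ _ _ _ _ _ _ H) addrC /GRing.scale/=.
  by congr (_ + _); rewrite mulrC.
exists (v - k *: z); split.
  have := bochner_integralB mI fI uv hkz; congr has_bochner_integral.
  apply/funext => t; rewrite dprod scalerDl !scalerA (mulrC k (phi t)) addrK.
  by [].
have := bochner_integralD mI fI hkz wv; rewrite opprB.
congr has_bochner_integral; apply/funext => t.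
by rewrite scalerDr !scalerA (mulrC k (phi t)).
Qed.

End WeakDerivativeCalculus.

(** * Translation invariance *)

Section Translation.
Context {R : realType}.
Notation mu := (@lebesgue_measure R).
Variable h : R.
Implicit Types (X : normedModType R) (D : set (measurableTypeR R)).

Local Notation shifted := (fun t : R => t + h).
Local Notation preshift D := (shifted @^-1` D : set (measurableTypeR R)).

Lemma measurable_fun_translation :
  measurable_fun [set: measurableTypeR R] (shifted : measurableTypeR R -> measurableTypeR R).
Proof. exact: measurable_funD. Qed.

Lemma measurable_preshift D : measurable D -> measurable (preshift D).
Proof.
by move=> mD; rewrite -[X in measurable X]setTI; exact: measurable_fun_translation.
Qed.

(** Lebesgue measure is determined by its values on bounded intervals. *)
Lemma lebesgue_measure_preshift D : measurable D -> mu (preshift D) = mu D.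
Proof.
move=> mD; rewrite -[LHS]/(pushforward mu
  (shifted : measurableTypeR R -> measurableTypeR R) D).
apply/esym/lebesgue_measure_unique => //=.
  exact: measurable_fun_translation.
move=> _ _ [[a b] _ <-]; rewrite /pushforward.
rewrite (_ : _ @^-1` _ = `](a - h), (b - h)]%classic).
  rewrite !lebesgue_measure_itv/= !lte_fin ltrD2r.
  by case: ifP => // _; rewrite -!EFinB; congr EFin; ring.
by apply/seteqP; split => t /=; rewrite !in_itv/= ltrBlDr lerBrDr.
Qed.

Lemma integral_translation D (f : R -> \bar R) : measurable D ->
  measurable_fun D f -> (forall t, D t -> (0 <= f t)%E) ->
  (\int[mu]_(t in preshift D) f (t + h)%R = \int[mu]_(t in D) f t)%E.
Proof.
move=> mD mf f0.
rewrite -(@ge0_integral_pushforward _ _ _ _ _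
  (shifted : measurableTypeR R -> measurableTypeR R) measurable_fun_translation mu D f)//.
  apply: (eq_measure_integral mu); first exact: measurable_fun_translation.
  by move=> ? A mA _; exact: lebesgue_measure_preshift.
by move=> t /set_mem; exact: f0.
Qed.

Lemma ae_translation (P : R -> Prop) : {ae mu, forall t : R, P t} ->
  {ae mu, forall t : R, P (t + h)}.
Proof.
move=> [N [mN N0 PN]]; exists (preshift N); split.
- exact: measurable_preshift.
- by rewrite lebesgue_measure_preshift.
- by move=> t; exact: (PN (t + h)).
Qed.

Lemma range_translation (T : Type) (s : R -> T) : range (fun t => s (t + h)) = range s.
Proof.
apply/seteqP; split => [_ [t _ <-]|_ [t _ <-]]; first by exists (t + h).
by exists (t - h) => //; rewrite subrK.
Qed.

Lemma simple_fun_translation X (s : R -> X) :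
  simple_fun s -> simple_fun (fun t => s (t + h)).
Proof.
move=> [fs ms]; split; first by rewrite range_translation.
by move=> x; exact: (measurable_preshift (ms x)).
Qed.

Lemma strongly_measurable_translation X D (f : R -> X) :
  strongly_measurable D f -> strongly_measurable (preshift D) (fun t => f (t + h)).
Proof.
move=> [s [ss sf]]; exists (fun n t => s n (t + h)); split.
  by move=> n; exact: simple_fun_translation.
by move=> t Dt; exact: sf.
Qed.

Lemma simple_integral_translation X D (s : R -> X) : measurable D -> simple_fun s ->
  simple_integral (preshift D) (fun t => s (t + h)) = simple_integral D s.
Proof.
move=> mD [fs ms]; rewrite /simple_integral range_translation.
apply: eq_fsbigr => x _; congr (_ *: _); congr fine.
apply: (lebesgue_measure_preshift (D := D `&` s @^-1` [set x])).
exact: measurableI.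
Qed.

Lemma bochner_integral_translation X D (f : R -> X) v : measurable D ->
  has_bochner_integral D f v ->
  has_bochner_integral (preshift D) (fun t => f (t + h)) v.
Proof.
move=> mD [mf [s [ss sf sv]]]; split; first exact: strongly_measurable_translation.
have ss' n : simple_fun (s n) by have [] := ss n.
exists (fun n t => s n (t + h)); split.
- move=> n; split; first exact: simple_fun_translation.
  move=> x x0; have [_ /(_ x x0)] := ss n; apply: le_lt_trans.
  rewrite le_eqVlt; apply/orP; left; apply/eqP.
  apply: (lebesgue_measure_preshift (D := D `&` s n @^-1` [set x])).
  by apply: measurableI => //; case: (ss' n).
- apply: cvg_trans sf; apply: near_eq_cvg; apply: nearW => n.
  rewrite -(@integral_translation D (fun t => (`|f t - s n t|)%:E))//.
  apply: measurable_enorm => //; apply: strongly_measurableB => //.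
  exact: strongly_measurable_simple.
- apply: cvg_trans sv; apply: near_eq_cvg; apply: nearW => n.
  by rewrite simple_integral_translation.
Qed.

Lemma preshift_itv (a b : R) : preshift `[a + h, b + h]%classic = `[a, b]%classic.
Proof. by apply/seteqP; split => t /=; rewrite !in_itv/= !lerD2r. Qed.

Lemma weak_derivative_translation X (a b : R) (u w : R -> X) :
  weak_derivative `[a + h, b + h] u w ->
  weak_derivative `[a, b] (fun t => u (t + h)) (fun t => w (t + h)).
Proof.
move=> d phi [sphi [K [cK KI K0]]].
have mI : measurable (`[a + h, b + h]%classic : set (measurableTypeR R)).
  exact: measurable_itv.
have tphi : test_function `[a + h, b + h] (fun t => phi (1 * t - h)).
  split; first exact: smooth_affine.
  exists (shifted @` K); split.
  - apply: continuous_compact => //; apply: continuous_subspaceT => t.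
    by apply: cvgD; [exact: cvg_id|exact: cvg_cst].
  - move=> _ [t /KI + <-]; rewrite !interior_itv/= !in_itv/=; lra.
  - move=> t Kt; apply: K0 => Kt'; apply: Kt; exists (1 * t - h) => //.
    by rewrite mul1r subrK.
have dphi t : derive1 (fun t => phi (1 * t - h)) (t + h) = derive1 phi t.
  rewrite derive1E.
  have da : is_derive (t + h) (1 : R) (fun t : R => 1 * t - h) 1.
    by apply: is_derive_eq; rewrite /GRing.scale/= ?mulr0 ?oppr0 ?addr0 ?mulr1.
  have H := @is_derive1_comp _ phi (fun t => 1 * t - h) (t + h) _ _
    (smooth_is_derive _ sphi) da.
  by rewrite (@derive_val _ _ _ _ _ _ _ H) mul1r addrK mulr1.
have [v [uv wv]] := d _ tphi; exists v; split.
  have := bochner_integral_translation mI uv; rewrite preshift_itv.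
  by congr has_bochner_integral; apply/funext => t; rewrite dphi.
have := bochner_integral_translation mI wv; rewrite preshift_itv.
by congr has_bochner_integral; apply/funext => t; rewrite mul1r addrK.
Qed.

Lemma Lp_enorm_translation X (p : R) D (f : R -> X) : measurable D ->
  strongly_measurable D f ->
  Lp_enorm p (preshift D) (fun t => f (t + h)) = Lp_enorm p D f.
Proof.
move=> mD mf; rewrite !Lp_enormE unlock.
have mF := measurable_restricted_norm mD mf.
have := @integral_translation setT
  (fun t => `|(\1_D t * `|f t|)%:E| `^ p)%E measurableT.
rewrite preimage_setT => H; congr (_ `^ _)%E; rewrite -[RHS]H//.
- apply: (@measurableT_comp _ _ _ _ _ _ (fun x : \bar R => x `^ p)%E).
    exact: measurable_poweR.
  by apply: measurableT_comp => //; exact/measurable_EFinP.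
- by move=> t _; exact: poweR_ge0.
Qed.

Lemma Lp_translation X (p a b : R) (f : R -> X) : Lp p `[a + h, b + h] f ->
  Lp p `[a, b] (fun t => f (t + h)) /\
  Lp_norm p `[a, b] (fun t => f (t + h)) = Lp_norm p `[a + h, b + h] f.
Proof.
have mI : measurable (`[a + h, b + h]%classic : set (measurableTypeR R)).
  exact: measurable_itv.
move=> [mf foo]; have := Lp_enorm_translation p mI mf; rewrite preshift_itv => H.
rewrite /Lp_norm /Lp H; split => //; split => //.
by have := strongly_measurable_translation mf; rewrite preshift_itv.
Qed.

Lemma trace_at_translation X (a b : R) (u : R -> X) c x :
  trace_at `[a + h, b + h] u (c + h) x -> trace_at `[a, b] (fun t => u (t + h)) c x.
Proof.
have sub t : `[a, b]%classic t -> `[a + h, b + h]%classic (t + h).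
  by rewrite /= !in_itv/= !lerD2r.
move=> [v [cv vu <-]]; exists (fun t => v (t + h)); split => //.
  apply/subspace_continuousP => t tI.
  have /subspace_continuousP/(_ _ (sub t tI))/cvgrPdist_lt H := cv.
  apply/cvgrPdist_lt => e e0; have := H e e0.
  rewrite /within/= => /nbhs_ballP[d d0 Hd].
  apply/nbhs_ballP; exists d => // s; rewrite /ball/= => ts /sub sI.
  by apply: Hd => //; rewrite /ball/= opprD addrACA subrr addr0.
have := ae_translation vu; apply: ae_imp => t H tI; exact/H/sub.
Qed.

End Translation.

(** * Extension by zero and countable gluing in Lebesgue spaces *)

Section Cut.
Context {R : realType}.
Notation mu := (@lebesgue_measure R).
Implicit Types (X : normedModType R) (D E : set (measurableTypeR R)).

Lemma strongly_measurable_cut X D E (f : R -> X) : measurable E ->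
  strongly_measurable (D `&` E) f -> strongly_measurable D (fun t => \1_E t *: f t).
Proof.
move=> mE [s [ss sf]]; exists (fun n t => \1_E t *: s n t); split.
  by move=> n; exact: simple_fun_restrict.
move=> t Dt; rewrite indicE; have [/set_mem Et|_] := boolP (t \in E).
  by under eq_fun do rewrite scale1r; rewrite scale1r; exact: sf.
by under eq_fun do rewrite scale0r; rewrite scale0r; exact: cvg_cst.
Qed.

Lemma Lp_cut X (p : R) D E (f : R -> X) : measurable E -> E `<=` D -> Lp p E f ->
  Lp p D (fun t => \1_E t *: f t) /\
  Lp_norm p D (fun t => \1_E t *: f t) = Lp_norm p E f.
Proof.
move=> mE ED [mf foo].
have H : Lp_enorm p D (fun t => \1_E t *: f t) = Lp_enorm p E f.
  rewrite !Lp_enormE; congr (Lnorm _ _ _); apply/funext => t /=.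
  rewrite normrZ mulrA !indicE; have [/set_mem Et|_] := boolP (t \in E).
    by rewrite mem_set ?normr1 ?mulr1//; exact: ED.
  by rewrite normr0 mulr0.
rewrite /Lp_norm /Lp H; split => //; split => //.
by apply: strongly_measurable_cut => //; apply: strongly_measurableS mf => t [].
Qed.

Lemma LpZ X (p k : R) D (f : R -> X) : 1 < p -> measurable D -> Lp p D f ->
  Lp p D (fun t => k *: f t) /\
  Lp_norm p D (fun t => k *: f t) <= `|k| * Lp_norm p D f.
Proof.
move=> p1 mD Lf; apply: Lp_dominated => //; first exact: strongly_measurableZl Lf.1.
by apply: aeW => t _; rewrite normrZ.
Qed.

Lemma Lp_enorm_powR X (p : R) D (f : R -> X) : 0 < p -> measurable D ->
  (Lp_enorm p D f `^ p = \int[mu]_(t in D) (`|f t| `^ p)%:E)%E.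
Proof.
move=> p0 mD; rewrite Lp_enormE poweR_Lnorm ?gt_eqF// [RHS]integral_mkcond.
apply: eq_integral => t _; rewrite patchE/= indicE; case: ifP => _.
  by rewrite mul1r normr_id.
by rewrite mul0r normr0 powR0 ?gt_eqF.
Qed.

(** As p >= 1 and the norms are below 1, their p-th powers, which are what adds
    up over disjoint pieces, are below a geometric series. *)
Lemma Lp_bigcup X (p : R) (E : nat -> set (measurableTypeR R)) (f : R -> X) :
  1 < p -> (forall n, measurable (E n)) -> trivIset setT E ->
  (forall n, Lp p (E n) f /\ Lp_norm p (E n) f <= 1 / (2 ^ n.+1)%:R) ->
  Lp p (\bigcup_n E n) f.
Proof.
move=> p1 mE tE LE; have p0 : 0 < p := lt_trans ltr01 p1.
have mU : measurable (\bigcup_n E n) by exact: bigcup_measurable.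
have mf : strongly_measurable (\bigcup_n E n) f.
  by apply: strongly_measurable_bigcup => // n; case: (LE n) => -[].
split => //.
have foo : (\int[mu]_(t in \bigcup_n E n) (`|f t| `^ p)%:E < +oo)%E.
  rewrite ge0_integral_bigcup//; last first.
    apply/measurable_EFinP.
    apply: (@measurableT_comp _ _ _ _ _ _ (fun x : R => x `^ p)) => //.
    exact: measurable_norm.
  apply: le_lt_trans (ltry 1); apply: le_trans (epsilon_trick0 xpredT ler01).
  apply: lee_nneseries => [n _ _|n _]; first by rewrite integral_ge0.
  have [Lf fn] := LE n; rewrite -Lp_enorm_powR// -Lp_normK// poweR_EFin lee_fin.
  apply: le_trans fn; have := Lp_norm_ge0 p (E n) f; rewrite le_eqVlt => /orP[/eqP <-|n0].
    by rewrite powR0// gt_eqF.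
  rewrite -[leRHS]powRr1 ?Lp_norm_ge0//; apply: ger_powR; last exact: ltW.
  rewrite n0/=; apply: le_trans (LE n).2 _.
  by rewrite ler_pdivrMr ?ltr0n ?expn_gt0// mul1r ler1n expn_gt0.
rewrite -Lp_enorm_powR// in foo.
have := poweR_lty p^-1 foo.
by rewrite -poweRrM mulfV ?gt_eqF// poweRe1 ?Lp_enorm_ge0.
Qed.

End Cut.

(** * Solutions of the evolution equation *)

Lemma wderivP {R : realType} {X : normedModType R} (p : R) (I : set R) (u : R -> X) :
  (exists w, Lp p I w /\ weak_derivative I u w) ->
  Lp p I (wderiv p I u) /\ weak_derivative I u (wderiv p I u).
Proof. exact: (@xgetPex _ (fun=> 0) [set w | Lp p I w /\ weak_derivative I u w]). Qed.

Section Solutions.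
Context {R : realType} {X0 X1 : completeNormedModType R}.
Notation mu := (@lebesgue_measure R).
Variables (iota : {linear X1 -> X0}) (p : R) (A : {linear X1 -> X0}).
Hypotheses (iota_cont : continuous iota) (p1 : 1 < p) (A_cont : continuous A).

(** The equation with u' replaced by f - A u, so that no choice of a weak
    derivative is involved; see [is_solutionP]. *)
Definition solves (a b : R) (f : R -> X0) (u : R -> X1) : Prop :=
  [/\ Lp p `[a, b] u,
      weak_derivative `[a, b] (iota \o u) (fun t => f t - A (u t))
    & trace_at `[a, b] (iota \o u) a 0].

Let mI (a b : R) : measurable (`[a, b]%classic : set (measurableTypeR R)).
Proof. exact: measurable_itv. Qed.

Let fI := @segment_finite R.

Lemma subitv_init (a c b : R) : c <= b -> `[a, c]%classic `<=` `[a, b]%classic.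
Proof. by move=> cb t /=; rewrite !in_itv/=; lra. Qed.

Lemma subitv_tail (a c b : R) : a <= c -> `[c, b]%classic `<=` `[a, b]%classic.
Proof. by move=> ac t /=; rewrite !in_itv/=; lra. Qed.

Lemma Lp_linear_comp (B : {linear X1 -> X0}) (a b : R) (u : R -> X1) :
  continuous B -> Lp p `[a, b] u -> Lp p `[a, b] (B \o u).
Proof.
move=> cB Lu; have [K K0 HK] := linear_norm_bound cB.
by have [] := Lp_comp p1 (mI a b) cB K0 HK Lu.
Qed.

Lemma Lp_residual (a b : R) (f : R -> X0) (u : R -> X1) :
  Lp p `[a, b] f -> Lp p `[a, b] u -> Lp p `[a, b] (fun t => f t - A (u t)).
Proof.
by move=> Lf Lu; have [] := LpB p1 (mI a b) Lf (Lp_linear_comp A_cont Lu).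
Qed.

(** The selected weak derivative agrees with f - A u almost everywhere, because
    weak derivatives are unique. *)
Lemma is_solutionP (a b : R) (f : R -> X0) (u : R -> X1) : Lp p `[a, b] f ->
  is_solution p iota A a b f u <-> solves a b f u.
Proof.
move=> Lf; split.
  move=> [[[Liu [w [Lw dw]]] Lu] eqn tr]; split => //.
  have [Lw' dw'] := wderivP (ex_intro _ w (conj Lw dw)).
  apply: ae_eq_weak_derivative dw' => //; first by case: (Lp_residual Lf Lu).
  by apply: ae_imp eqn => t eqn It; rewrite -eqn// addrK.
move=> [Lu du tr]; have Lr := Lp_residual Lf Lu.
have [Lw' dw'] := wderivP (ex_intro _ (fun t => f t - A (u t)) (conj Lr du)).
split => //.
  split => //; split; first exact: Lp_linear_comp.
  by exists (fun t => f t - A (u t)).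
have : ae_eq_on `[a, b] (wderiv p `[a, b] (iota \o u)) (fun t => f t - A (u t)).
  apply: weak_derivative_unique dw' du.
  - by case: Lw'.
  - by case: Lr.
  - exact: Lp_integrable Lw'.
  - exact: Lp_integrable Lr.
by apply: ae_imp => t E It; rewrite E// subrK.
Qed.

(** A solution has derivative f - A u, so that beyond |f| only the norm of u in
    L^p(X_1) has to be controlled. *)
Lemma E1_norm_solution : exists2 K, 0 <= K & forall (a b : R) f u,
  Lp p `[a, b] f -> is_solution p iota A a b f u ->
  E1_norm p iota `[a, b] u <= K * Lp_norm p `[a, b] u + Lp_norm p `[a, b] f.
Proof.
have [Ki Ki0 HKi] := linear_norm_bound iota_cont.
have [Ka Ka0 HKa] := linear_norm_bound A_cont.
exists (Ki + Ka + 1); first by rewrite !addr_ge0.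
move=> a b f u Lf su; have [[[Liu [w [Lw dw]]] Lu] eqn tr] := su.
have [Lw' dw'] := wderivP (ex_intro _ w (conj Lw dw)).
have [_ n1] := Lp_comp p1 (mI a b) iota_cont Ki0 HKi Lu.
have [LAu n2] := Lp_comp p1 (mI a b) A_cont Ka0 HKa Lu.
have [Lr n3] := LpB p1 (mI a b) Lf LAu.
have n4 : Lp_norm p `[a, b] (wderiv p `[a, b] (iota \o u)) =
    Lp_norm p `[a, b] (fun t => f t - (A \o u) t).
  have [] // := ae_eq_Lp_norm p1 (mI a b) Lr Lw'.1.
  by apply: ae_imp eqn => t eqn It; rewrite -eqn//= addrK.
by rewrite /E1_norm /W1p_norm n4 /=; lra.
Qed.

Lemma ae_eq_solves (a b : R) (f g : R -> X0) (u : R -> X1) : Lp p `[a, b] g ->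
  ae_eq_on `[a, b] f g -> solves a b f u -> solves a b g u.
Proof.
move=> Lg fg [Lu du tr]; split => //; apply: ae_eq_weak_derivative du => //.
  by case: (Lp_residual Lg Lu).
by apply: ae_imp fg => t fg It; rewrite fg.
Qed.

Lemma Lp0 (X : normedModType R) (a b : R) : Lp p `[a, b] (fun=> 0 : X).
Proof.
split; first exact: strongly_measurable_cst.
rewrite Lp_enormE (_ : _ \o _ = cst 0%E); last first.
  by apply/funext => t /=; rewrite normr0 mulr0.
by rewrite Lnorm0// eqe gt_eqF// (lt_trans _ p1).
Qed.

Lemma solves0 (a b : R) : solves a b (fun=> 0) (fun=> 0).
Proof.
split; first exact: Lp0.
  move=> phi tphi; exists 0; rewrite oppr0.
  have H : has_bochner_integral `[a, b] (fun=> 0 : X0) 0.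
    by have := bochner_integral_cst (mI a b) (fI a b) (0 : X0); rewrite scaler0.
  split; move: H; congr has_bochner_integral; apply/funext => t /=.
    by rewrite linear0 scaler0.
  by rewrite linear0 subrr scaler0.
exists (fun=> 0); split => //.
  by apply: continuous_subspaceT => t; exact: cvg_cst.
by apply: aeW => t _ /=; rewrite linear0.
Qed.

Lemma solvesB (a b : R) (f g : R -> X0) (u v : R -> X1) :
  solves a b f u -> solves a b g v ->
  solves a b (fun t => f t - g t) (fun t => u t - v t).
Proof.
move=> [Lu du tu] [Lv dv tv]; split.
- by have [] := LpB p1 (mI a b) Lu Lv.
- have := weak_derivativeB (mI a b) (fI a b) du dv.
  congr weak_derivative; apply/funext => t /=; first by rewrite linearB.
  by rewrite (linearB A) !opprB addrACA [RHS]addrACA; congr (_ + _); rewrite addrC.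
- have := trace_atB tu tv; rewrite subrr; congr trace_at.
  by apply/funext => t /=; rewrite linearB.
Qed.

Lemma solvesZ (a b k : R) (f : R -> X0) (u : R -> X1) :
  solves a b f u -> solves a b (fun t => k *: f t) (fun t => k *: u t).
Proof.
move=> [Lu du tu]; split.
- by have [] := LpZ k p1 (mI a b) Lu.
- have := weak_derivativeZ k (mI a b) (fI a b) du.
  congr weak_derivative; apply/funext => t /=; first by rewrite linearZ.
  by rewrite linearZ/= scalerBr.
- have ck : continuous (fun _ : R => k) by exact: cst_continuous.
  have := trace_atZ ck tu; rewrite scaler0.
  rewrite (_ : (fun t => _) = iota \o (fun t => k *: u t))//.
  by apply/funext => t /=; rewrite linearZ.
Qed.

Lemma solves_init (a c b : R) (f : R -> X0) (u : R -> X1) : c <= b ->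
  solves a b f u -> solves a c f u.
Proof.
move=> cb [Lu du tu]; have sub := @subitv_init a c b cb; split.
- by have [] := LpS p1 (mI a c) (mI a b) sub Lu.
- exact: weak_derivativeS du.
- exact: trace_atS tu.
Qed.

Lemma solves_tail (a c b : R) (f : R -> X0) (u : R -> X1) : a < c -> c <= b ->
  ae_eq_on `[a, c] u (fun=> 0) -> solves a b f u -> solves c b f u.
Proof.
move=> ac cb u0 [Lu du tu]; have sub := @subitv_tail a c b (ltW ac); split.
- by have [] := LpS p1 (mI c b) (mI a b) sub Lu.
- exact: weak_derivativeS du.
- apply: (trace_at_vanishing ac cb tu).
  by apply: ae_imp u0 => t u0 It /=; rewrite u0// linear0.
Qed.

Lemma solves_translation (h a b : R) (f : R -> X0) (u : R -> X1) :
  solves (a + h) (b + h) f u ->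
  solves a b (fun t => f (t + h)) (fun t => u (t + h)).
Proof.
move=> [Lu du tu]; split.
- by have [] := Lp_translation Lu.
- exact: (weak_derivative_translation du).
- exact: (trace_at_translation tu).
Qed.

(** Boundedness of the solution operator from L^p(X_0) to L^p(X_1); by
    [E1_norm_solution] this is equivalent to boundedness into E_1. *)
Definition solution_bounded (a b : R) : Prop := exists2 C, 0 <= C &
  forall f u, Lp p `[a, b] f -> solves a b f u ->
    Lp_norm p `[a, b] u <= C * Lp_norm p `[a, b] f.

Lemma solution_bounded_translation (h a b : R) :
  solution_bounded a b -> solution_bounded (a + h) (b + h).
Proof.
move=> [C C0 HC]; exists C => // f u Lf su.
have [Lf' <-] := Lp_translation Lf; have [_ <-] := Lp_translation (let: And3 L _ _ := su in L).
by apply: HC => //; exact: solves_translation.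
Qed.

Hypothesis max_reg : forall a b : R, a < b -> maximal_regularity p iota A a b.

Lemma solves_ex (a b : R) (f : R -> X0) : a < b -> Lp p `[a, b] f ->
  exists u, solves a b f u.
Proof.
by move=> ab Lf; have [u [/(is_solutionP _ Lf) su _]] := max_reg ab Lf; exists u.
Qed.

Lemma solves_unique (a b : R) (f g : R -> X0) (u v : R -> X1) : a < b ->
  Lp p `[a, b] f -> Lp p `[a, b] g -> ae_eq_on `[a, b] f g ->
  solves a b f u -> solves a b g v -> ae_eq_on `[a, b] u v.
Proof.
move=> ab Lf Lg fg su sv; have [w [_ wu]] := max_reg ab Lg.
have uw := wu _ ((is_solutionP _ Lg).2 (ae_eq_solves Lg fg su)).
have vw := wu _ ((is_solutionP _ Lg).2 sv).
by apply: ae_imp2 uw vw => t uw vw It; rewrite uw// vw.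
Qed.

(** Extend the data by zero beyond c; the solution on [a, b] restricts to the
    solution on [a, c]. *)
Lemma solution_bounded_init (a c b : R) : a < c -> c <= b ->
  solution_bounded a b -> solution_bounded a c.
Proof.
move=> ac cb [C C0 HC]; exists C => // f u Lf su.
have sub := @subitv_init a c b cb; have ab := lt_le_trans ac cb.
have [LF nF] := Lp_cut (mI a c) sub Lf.
have [v sv] := solves_ex ab LF; have [Lv _ _] := sv.
have [LFc _] := LpS p1 (mI a c) (mI a b) sub LF.
have sv' := solves_init cb sv.
have vu : ae_eq_on `[a, c] v u.
  apply: solves_unique ac LFc Lf _ sv' su.
  by apply: aeW => t It; rewrite indicE mem_set// scale1r.
have [Lvc nvc] := LpS p1 (mI a c) (mI a b) sub Lv.
have [_ ->] := ae_eq_Lp_norm p1 (mI a c) Lvc (let: And3 L _ _ := su in L.1) vu.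
by rewrite -nF; apply: le_trans nvc _; exact: HC.
Qed.

(** Extend the data by zero before c; by uniqueness the solution on [a, b]
    vanishes up to c, and so restricts to the solution started at c. *)
Lemma solution_bounded_tail (a c b : R) : a < c -> c < b ->
  solution_bounded a b -> solution_bounded c b.
Proof.
move=> ac cb [C C0 HC]; exists C => // f u Lf su.
have sub := @subitv_tail a c b (ltW ac); have ab := lt_trans ac cb.
have [LF nF] := Lp_cut (mI c b) sub Lf.
have [v sv] := solves_ex ab LF; have [Lv _ _] := sv.
have [LFc _] := LpS p1 (mI c b) (mI a b) sub LF.
have [LFi _] := LpS p1 (mI a c) (mI a b) (@subitv_init a c b (ltW cb)) LF.
have v0 : ae_eq_on `[a, c] v (fun=> 0).
  apply: solves_unique ac LFi (Lp0 X0 a c) _ (solves_init (ltW cb) sv) (solves0 a c).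
  apply: ae_imp (ae_neq c) => t /eqP tc; rewrite /= in_itv/= => /andP[_ t_c].
  rewrite indicE memNset ?scale0r//= in_itv/= => /andP[ct _].
  by move: tc; rewrite eq_le t_c ct.
have sv' := solves_tail ac (ltW cb) v0 sv.
have vu : ae_eq_on `[c, b] v u.
  apply: solves_unique cb LFc Lf _ sv' su.
  by apply: aeW => t It; rewrite indicE mem_set// scale1r.
have [Lvc nvc] := LpS p1 (mI c b) (mI a b) sub Lv.
have [_ ->] := ae_eq_Lp_norm p1 (mI c b) Lvc (let: And3 L _ _ := su in L.1) vu.
by rewrite -nF; apply: le_trans nvc _; exact: HC.
Qed.

Lemma Lp_norm_split (X : normedModType R) (a d b : R) (f : R -> X) :
  a <= d -> d <= b -> Lp p `[a, b] f ->
  Lp_norm p `[a, b] f <= Lp_norm p `[a, d] f + Lp_norm p `[d, b] f.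
Proof.
move=> ad db Lf.
have [La _] := LpS p1 (mI a d) (mI a b) (@subitv_init a d b db) Lf.
have [Lb _] := LpS p1 (mI d b) (mI a b) (@subitv_tail a d b ad) Lf.
have [] // := Lp_dominated_add p1 (mI a b) (mI a d) (mI d b) Lf.1 La Lb.
apply: aeW => t; rewrite /= in_itv/= => /andP[a_t tb].
have [td|/ltW dt] := leP t d.
  rewrite [X in X * _ + _]indicE mem_set ?mul1r ?lerDl ?mulr_ge0//.
  by rewrite /= in_itv/= a_t td.
rewrite [X in _ + X * _]indicE mem_set ?mul1r ?lerDr ?mulr_ge0//.
by rewrite /= in_itv/= tb dt.
Qed.

Lemma trace_at_move (X : normedModType R) (D : set R) (u : R -> X) a c x :
  trace_at D u a x -> exists y, trace_at D u c y.
Proof. by move=> [v [cv vu _]]; exists (v c), v. Qed.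

Lemma trace_at_vanish (X : normedModType R) (a c b : R) (u : R -> X) x :
  a < c -> c <= b -> trace_at `[a, b] u c x ->
  ae_eq_on `[a, c] u (fun=> 0) -> x = 0.
Proof.
move=> ac cb [v [cv vu <-]] u0; apply: (ae_eq_within_continuous ac cb cv).
apply: ae_imp2 vu u0 => t vu u0 It; rewrite vu ?u0//.
exact: subitv_init cb _ It.
Qed.

(** The solution u is bounded on [a, d].  Let chi be affine with chi(c) = 0 and
    chi(d) = 1.  On [c, d], chi u solves the equation started at c, with data
    chi f + chi' u, which are bounded.  Cut these data off at d and let h be the
    corresponding solution on [c, b]: it is bounded, and equals chi u up to d.
    Hence u - h solves the equation on [d, b] with data f and initial value 0,
    so it is bounded as well. *)
Lemma solution_bounded_glue (a c d b : R) : a < c -> c < d -> d < b ->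
  solution_bounded a d -> solution_bounded c b -> solution_bounded a b.
Proof.
move=> ac cd db [C1 C10 HC1] bcb.
have [C3 C30 HC3] := solution_bounded_tail cd db bcb.
have [C2 C20 HC2] := bcb.
have [Ki Ki0 HKi] := linear_norm_bound iota_cont.
have ad := lt_trans ac cd; have cb := lt_trans cd db; have ab := lt_trans ad db.
(* The cut-off t |-> (t - c) / (d - c), written as k t + m. *)
pose k := (d - c)^-1; pose m := - (c * k).
have dc0 : 0 < d - c by rewrite subr_gt0.
have k0 : 0 < k by rewrite invr_gt0.
pose chi t := k * t + m.
have chic : chi c = 0 by rewrite /chi /m mulrC subrr.
have chid : chi d = 1 by rewrite /chi /m [c * k]mulrC -mulrBr mulVf// gt_eqF.
have chi1 t : `[c, d]%classic t -> `|chi t| <= 1.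
  rewrite /= in_itv/= => /andP[ct td]; rewrite ger0_norm.
    by rewrite -chid lerD2r ler_pM2l.
  by rewrite -chic lerD2r ler_pM2l.
have cchi : continuous chi.
  by move=> t; apply: cvgD; [apply: cvgM; [exact: cvg_cst|exact: cvg_id]|exact: cvg_cst].
pose K := 1 + k * Ki * C1.
have K0 : 0 <= K by rewrite addr_ge0// !mulr_ge0// ltW.
exists (C1 + (C3 + C2 * K)); first by rewrite !addr_ge0// mulr_ge0.
move=> f u Lf su.
have scd_ab : `[c, d]%classic `<=` `[a, b]%classic by move=> t /=; rewrite !in_itv/=; lra.
have scd_ad : `[c, d]%classic `<=` `[a, d]%classic by exact: subitv_tail (ltW ac).
have sad_ab : `[a, d]%classic `<=` `[a, b]%classic by exact: subitv_init (ltW db).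
have sdb_ab : `[d, b]%classic `<=` `[a, b]%classic by exact: subitv_tail (ltW ad).
have scb_ab : `[c, b]%classic `<=` `[a, b]%classic by exact: subitv_tail (ltW ac).
have scd_cb : `[c, d]%classic `<=` `[c, b]%classic by exact: subitv_init (ltW db).
have sdb_cb : `[d, b]%classic `<=` `[c, b]%classic by exact: subitv_tail (ltW cd).
have [Lu du tu] := su.
have [Lfad nfad] := LpS p1 (mI a d) (mI a b) sad_ab Lf.
have [Lfcd nfcd] := LpS p1 (mI c d) (mI a b) scd_ab Lf.
have [Lfdb nfdb] := LpS p1 (mI d b) (mI a b) sdb_ab Lf.
have [Luad _] := LpS p1 (mI a d) (mI a b) sad_ab Lu.
have [Lucd nucd] := LpS p1 (mI c d) (mI a d) scd_ad Luad.
have [Lucb _] := LpS p1 (mI c b) (mI a b) scb_ab Lu.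
have [Ludb _] := LpS p1 (mI d b) (mI a b) sdb_ab Lu.
have nu1 : Lp_norm p `[a, d] u <= C1 * Lp_norm p `[a, b] f.
  apply: le_trans (HC1 _ _ Lfad (solves_init (ltW db) su)) _.
  by rewrite ler_wpM2l.
have mchi D : strongly_measurable D (chi : R -> R^o).
  by apply: smooth_strongly_measurable; exact: (@smooth_affine _ id k m (@smooth_id R)).
pose G t := chi t *: f t + k *: iota (u t).
have [LG nG] : Lp p `[c, d] G /\ Lp_norm p `[c, d] G <= K * Lp_norm p `[a, b] f.
  have [L1 n1] : Lp p `[c, d] (fun t => chi t *: f t) /\
      Lp_norm p `[c, d] (fun t => chi t *: f t) <= 1 * Lp_norm p `[c, d] f.
    apply: Lp_dominated => //; first by apply: strongly_measurableZ => //; case: Lfcd.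
    by apply: aeW => t It; rewrite normrZ ler_wpM2r// chi1.
  have [L2 n2] : Lp p `[c, d] (fun t => k *: iota (u t)) /\
      Lp_norm p `[c, d] (fun t => k *: iota (u t)) <= (k * Ki) * Lp_norm p `[c, d] u.
    apply: Lp_dominated => //.
    - apply: strongly_measurableZl; apply: (strongly_measurable_comp iota_cont).
      by case: Lucd.
    - by rewrite mulr_ge0// ltW.
    - apply: aeW => t It; rewrite normrZ gtr0_norm// -mulrA.
      by apply: ler_wpM2l; [exact: ltW|exact: HKi].
  have [L12 n12] := LpD p1 (mI c d) L1 L2; split => //.
  apply: le_trans n12 _; rewrite /K mulrDl; apply: lerD.
    exact: le_trans n1 (ler_wpM2l ler01 nfcd).
  apply: le_trans n2 _; rewrite -[leRHS]mulrA; apply: ler_wpM2l.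
    by rewrite mulr_ge0 ?(ltW k0).
  exact: le_trans nucd nu1.
have [Lg ng] := Lp_cut (mI c d) scd_cb LG.
set g := (fun t => \1_(`[c, d]%classic) t *: G t) in Lg ng.
(* After d the solution h evolves freely from the value u(d). *)
have [h sh] := solves_ex cb Lg; have [Lh dh th] := sh.
have nh : Lp_norm p `[c, b] h <= C2 * K * Lp_norm p `[a, b] f.
  apply: le_trans (HC2 _ _ Lg sh) _; rewrite ng -mulrA.
  by rewrite ler_wpM2l.
have [y ty] := trace_at_move c tu.
have schiu : solves c d G (fun t => chi t *: u t).
  split.
  - have [] // : Lp p `[c, d] (fun t => chi t *: u t) /\
      Lp_norm p `[c, d] (fun t => chi t *: u t) <= 1 * Lp_norm p `[c, d] u.
    apply: Lp_dominated => //; first by apply: strongly_measurableZ => //; case: Lucd.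
    by apply: aeW => t It; rewrite normrZ ler_wpM2r// chi1.
  - have Liu := Lp_linear_comp iota_cont Lucd.
    have := weak_derivative_affineM k m Liu.1 (Lp_integrable p1 (mI c d) (fI c d) Liu)
      (weak_derivativeS scd_ab du).
    congr weak_derivative; apply/funext => t /=; first by rewrite linearZ.
    by rewrite linearZ/= scalerBr -/(chi t) addrA [k *: _ + _]addrC.
  - have := trace_atZ cchi (trace_atS scd_ab ty); rewrite chic scale0r.
    rewrite (_ : (fun t => _) = iota \o (fun t => chi t *: u t))//.
    by apply/funext => t /=; rewrite linearZ.
have hchiu : ae_eq_on `[c, d] h (fun t => chi t *: u t).
  have [Lgcd _] := LpS p1 (mI c d) (mI c b) scd_cb Lg.
  apply: (solves_unique cd Lgcd LG _ (solves_init (ltW db) sh) schiu).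
  by apply: aeW => t It; rewrite /g indicE mem_set// scale1r.
have sz : solves d b f (fun t => u t - h t).
  have [Lhdb _] := LpS p1 (mI d b) (mI c b) sdb_cb Lh.
  have Lz := (LpB p1 (mI d b) Ludb Lhdb).1; split => //.
  - have := weak_derivativeB (mI c b) (fI c b) (weak_derivativeS scb_ab du) dh.
    move=> /(weak_derivativeS sdb_cb).
    rewrite (_ : (fun t => _ - _) = iota \o (fun t => u t - h t)); last first.
      by apply/funext => t /=; rewrite linearB.
    apply: ae_eq_weak_derivative => //; first by case: (Lp_residual Lfdb Lz).
    apply: ae_imp (ae_neq d) => t /eqP td; rewrite /= in_itv/= => /andP[dt _].
    rewrite /g indicE memNset ?scale0r//=; last first.
      by rewrite in_itv/= => /andP[_ t_d]; move: td; rewrite eq_le t_d dt.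
    by rewrite sub0r opprK (linearB A) opprB addrA addrAC.
  (* The continuous representatives of iota u and iota h agree at d,
     because chi u = h up to d and chi(d) = 1. *)
  - have [y1 ty1] := trace_at_move d (trace_atS scb_ab tu).
    have [y2 ty2] := trace_at_move d th.
    have := trace_atB (trace_atZ cchi ty1) ty2; rewrite chid scale1r => ty12.
    have y12 : y1 - y2 = 0.
      apply: (trace_at_vanish cd (ltW db) ty12).
      by apply: ae_imp hchiu => t hchiu It /=; rewrite hchiu// linearZ subrr.
    have := trace_atS sdb_cb (trace_atB ty1 ty2); rewrite y12.
    rewrite (_ : (fun t => _) = iota \o (fun t => u t - h t))//.
    by apply/funext => t /=; rewrite linearB.
have nz : Lp_norm p `[d, b] (fun t => u t - h t) <= C3 * Lp_norm p `[a, b] f.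
  by apply: le_trans (HC3 _ _ Lfdb sz) _; rewrite ler_wpM2l.
apply: le_trans (Lp_norm_split (ltW ad) (ltW db) Lu) _.
rewrite mulrDl; apply: lerD => //.
have [Lhdb nhdb] := LpS p1 (mI d b) (mI c b) sdb_cb Lh.
have [Lz _ _] := sz; have [_ ] := LpD p1 (mI d b) Lz Lhdb.
rewrite (_ : (fun t => _ + h t) = u); last by apply/funext => t; rewrite subrK.
move=> H; apply: le_trans H _; rewrite mulrDl; apply: lerD => //.
exact: le_trans nhdb nh.
Qed.

(** Gluing a translate of [0, l] that overlaps by l / 2 lengthens the interval
    by l / 2 at each step. *)
Lemma solution_bounded_everywhere (l : R) : 0 < l -> solution_bounded 0 l ->
  forall a b, a < b -> solution_bounded a b.
Proof.
move=> l0 b0 a b ab.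
have step (n : nat) : solution_bounded 0 (l + n%:R * (l / 2)).
  elim: n => [|n IH]; first by rewrite mul0r addr0.
  have ln : 0 <= n%:R * (l / 2) by rewrite mulr_ge0 ?divr_ge0// ltW.
  have l20 : 0 < l / 2 by rewrite divr_gt0.
  apply: (@solution_bounded_glue 0 (n%:R * (l / 2) + l / 2) (l + n%:R * (l / 2))) => //.
  - lra.
  - lra.
  - by rewrite -(natr1 n) mulrDl; lra.
  have := solution_bounded_translation (n%:R * (l / 2) + l / 2) b0; rewrite add0r.
  by congr solution_bounded; rewrite -(natr1 n); lra.
have [n abn] : exists n : nat, b - a < l + n%:R * (l / 2).
  have l20 : 0 < l / 2 by rewrite divr_gt0.
  exists (Num.truncn ((b - a) / (l / 2))).+1.
  have : (b - a) / (l / 2) < (Num.truncn ((b - a) / (l / 2))).+1%:R.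
    exact: truncnS_gt.
  by rewrite ltr_pdivrMr//; lra.
have H : solution_bounded 0 (b - a).
  by apply: solution_bounded_init (ltW abn) (step n); rewrite subr_gt0.
by have := solution_bounded_translation a H; rewrite add0r subrK.
Qed.

(** Rescale data that violate the bound with constant |M| / e. *)
Lemma unbounded_hump (c d e M : R) : c < d -> ~ solution_bounded c d -> 0 < e ->
  exists gw : (R -> X0) * (R -> X1), [/\ Lp p `[c, d] gw.1,
    solves c d gw.1 gw.2, Lp_norm p `[c, d] gw.1 <= e & M <= Lp_norm p `[c, d] gw.2].
Proof.
move=> cd nb e0; apply: contrapT => H; apply: nb.
exists (`|M| / e); first by rewrite divr_ge0// ltW.
move=> f u Lf su; have [Lu _ _] := su.
rewrite leNgt; apply/negP => fu; apply: H.
have f0 : 0 < Lp_norm p `[c, d] f.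
  rewrite lt0r Lp_norm_ge0 andbT; apply/eqP => f0; move: fu; rewrite f0 mulr0.
  have u0 := solves_unique cd Lf (Lp0 X0 c d) (Lp_norm_eq0 p1 (mI c d) Lf f0) su
    (solves0 c d).
  have [_ <-] := ae_eq_Lp_norm p1 (mI c d) Lu (Lp0 X1 c d).1 u0.
  rewrite /Lp_norm Lp_enormE (_ : _ \o _ = cst 0%E); last first.
    by apply/funext => t /=; rewrite normr0 mulr0.
  by rewrite Lnorm0 ?ltxx// eqe gt_eqF// (lt_trans _ p1).
set k := e / Lp_norm p `[c, d] f; have k0 : 0 < k by rewrite divr_gt0.
have [Lkf nkf] := LpZ k p1 (mI c d) Lf; have [Lku _] := LpZ k p1 (mI c d) Lu.
exists (fun t => k *: f t, fun t => k *: u t); split => //=.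
- exact: solvesZ.
- by apply: le_trans nkf _; rewrite gtr0_norm// /k mulfVK// gt_eqF.
have [_] := LpZ k^-1 p1 (mI c d) Lku.
rewrite (_ : (fun t => _) = u); last first.
  by apply/funext => t; rewrite scalerA mulVf ?scale1r// gt_eqF.
rewrite gtr0_norm ?invr_gt0// mulrC ler_pdivlMr// mulrC => H.
apply: le_trans H; apply: le_trans (ler_norm M) _.
have := ltW fu; rewrite -(ler_pM2l k0); apply: le_trans.
rewrite /k le_eqVlt; apply/orP; left; apply/eqP.
by field; rewrite !gt_eqF.
Qed.

(** By contradiction, with a gliding hump on the intervals [c_n, c_(n+1)] where
    c_n = 1 - 1/(n + 2). *)
Theorem maximal_regularity_bounded (a b : R) : a < b -> solution_bounded a b.
Proof.
move=> ab; apply: contrapT => nb.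
have nball c d : c < d -> ~ solution_bounded c d.
  move=> cd bcd; apply: nb; apply: (@solution_bounded_everywhere (d - c)) => //.
    by rewrite subr_gt0.
  by have := solution_bounded_translation (- c) bcd; rewrite subrr.
pose c (n : nat) : R := 1 - n.+2%:R^-1.
have c01 n : 0 < c n < 1.
  rewrite subr_gt0 invf_lt1 ?ltr0n// ltr1n/=.
  by rewrite ltrBlDr ltrDl invr_gt0 ltr0n.
have c_le n m : (n <= m)%N -> c n <= c m.
  move=> nm; rewrite lerD2l lerN2 lef_pV2 ?posrE ?ltr0n//.
  by rewrite ler_nat.
have c_lt n : c n < c n.+1.
  by rewrite ltrD2l ltrN2 ltf_pV2 ?posrE ?ltr0n// ltr_nat.
pose E (n : nat) : set (measurableTypeR R) := `[c n, c n.+1[%classic.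
have mE n : measurable (E n) by exact: measurable_itv.
have E_J n : E n `<=` `[c n, c n.+1]%classic.
  by move=> t; rewrite /E/= !in_itv/= => /andP[-> /ltW].
have J_01 n : `[c n, c n.+1]%classic `<=` `[0, 1]%classic.
  by move=> t /=; rewrite !in_itv/=; have := c01 n; have := c01 n.+1; lra.
have E_lt n m t : E n t -> E m t -> (n <= m)%N.
  rewrite /E/= !in_itv/= => /andP[nt _] /andP[_ tm]; rewrite leqNgt; apply/negP => mn.
  by have := lt_le_trans tm (c_le _ _ mn); rewrite ltNge nt.
have E_inj n m t : E n t -> E m t -> n = m.
  move=> En Em; apply/eqP; rewrite eqn_leq (E_lt n m t)//; exact: E_lt Em En.
have tE : trivIset setT E by move=> n m _ _ [t [En Em]]; exact: E_inj En Em.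
have /choice[G HG] : forall nM : nat * R, exists gw : (R -> X0) * (R -> X1),
    [/\ Lp p `[c nM.1, c nM.1.+1] gw.1, solves (c nM.1) (c nM.1.+1) gw.1 gw.2,
      Lp_norm p `[c nM.1, c nM.1.+1] gw.1 <= 1 / (2 ^ nM.1.+1)%:R
    & nM.2 <= Lp_norm p `[c nM.1, c nM.1.+1] gw.2].
  move=> [n M] /=; apply: unbounded_hump; [exact: c_lt|exact: nball|].
  by rewrite divr_gt0// ltr0n expn_gt0.
pose sol (f : R -> X0) : R -> X1 := xget (fun=> 0) [set u | solves 0 1 f u].
(* The response to be exceeded on J_n: F n carries the data chosen before. *)
pose M (n : nat) (f : R -> X0) := n%:R + Lp_norm p `[0, 1] (sol f).
pose F := fix F n : R -> X0 := if n is m.+1 then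
  (fun t => F m t + \1_(E m) t *: (G (m, M m (F m))).1 t) else fun=> 0.
pose g n := (G (n, M n (F n))).1; pose w n := (G (n, M n (F n))).2.
have FS n : F n.+1 = fun t => F n t + \1_(E n) t *: g n t by [].
have Hg n : [/\ Lp p `[c n, c n.+1] (g n), solves (c n) (c n.+1) (g n) (w n),
    Lp_norm p `[c n, c n.+1] (g n) <= 1 / (2 ^ n.+1)%:R
  & M n (F n) <= Lp_norm p `[c n, c n.+1] (w n)] by exact: (HG (n, M n (F n))).
have F_in n m t : E m t -> F n t = if (m < n)%N then g m t else 0.
  move=> Em; elim: n => [//|n IH]; rewrite FS IH; have [nm|mn] := eqVneq m n.
    by rewrite -nm ltnn ltnSn add0r indicE mem_set// scale1r.
  rewrite [in RHS]ltnS [in RHS]leq_eqVlt (negbTE mn)/= indicE memNset.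
    by rewrite scale0r addr0.
  by move=> En; move/eqP: mn; apply; exact: E_inj Em En.
have F_out n t : (forall m, ~ E m t) -> F n t = 0.
  move=> Et; elim: n => [//|n IH].
  by rewrite FS IH indicE memNset ?scale0r ?addr0.
have LE n : Lp p (E n) (g n) /\ Lp_norm p (E n) (g n) <= 1 / (2 ^ n.+1)%:R.
  have [Lg _ ng _] := Hg n; have [LEg nEg] := LpS p1 (mE n) (mI _ _) (@E_J n) Lg.
  by split => //; exact: le_trans nEg ng.
have LF n : Lp p `[0, 1] (F n).
  elim: n => [|n IH]; first exact: Lp0.
  have E01 : E n `<=` `[0, 1]%classic by apply: subset_trans (@J_01 n).
  by have [] := LpD p1 (mI 0 1) IH (Lp_cut (mE n) E01 (LE n).1).1.
pose Foo t := if pselect (exists m, E m t) is left h then g (sval (cid h)) t else 0.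
have Foo_in m t : E m t -> Foo t = g m t.
  move=> Em; rewrite /Foo; case: pselect => [h|[]]; last by exists m.
  by case: (cid h) => m' /= Em'; rewrite (E_inj _ _ _ Em' Em).
have Foo_out t : (forall m, ~ E m t) -> Foo t = 0.
  by move=> Et; rewrite /Foo; case: pselect => // -[m Em]; have := Et m.
have Foo_F n t : t < c n -> Foo t = F n t.
  move=> tcn; have [[m Em]|/forallNP Et] := pselect (exists m, E m t); last first.
    by rewrite Foo_out// F_out.
  rewrite (Foo_in _ _ Em) (F_in _ _ _ Em) ifT// ltnNge; apply/negP => /c_le.
  by move: Em; rewrite /E/= in_itv/= => /andP[cm _] cnm; move: tcn; lra.
have LFoo : Lp p `[0, 1] Foo.
  have mU : measurable (\bigcup_n E n : set (measurableTypeR R)).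
    exact: bigcup_measurable.
  have U01 : \bigcup_n E n `<=` `[0, 1]%classic by move=> t [n _ /E_J/J_01].
  have LU : Lp p (\bigcup_n E n) Foo.
    apply: Lp_bigcup => // n; have [Lg ng] := LE n.
    have mFoo : strongly_measurable (E n) Foo.
      by apply: eq_strongly_measurable Lg.1 => t Et; rewrite (Foo_in _ _ Et).
    have [Lg' ng'] : Lp p (E n) Foo /\ Lp_norm p (E n) Foo = Lp_norm p (E n) (g n).
      apply: ae_eq_Lp_norm => //.
      by apply: aeW => t Et; rewrite (Foo_in _ _ Et).
    by rewrite ng'.
  have [+ _] := Lp_cut mU U01 LU; rewrite (_ : (fun t => _) = Foo)//.
  apply/funext => t; rewrite indicE; have [|/negP tU] := boolP (t \in _).
    by rewrite scale1r.
  rewrite scale0r Foo_out// => m Em; apply: tU; apply/mem_set; by exists m.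
have [U sU] := solves_ex ltr01 LFoo; have [LU _ _] := sU.
have main n : n%:R <= Lp_norm p `[0, 1] U.
  have [Lg sw _ Mw] := Hg n.
  have sUn : solves 0 1 (F n) (sol (F n)).
    have [u su] := solves_ex ltr01 (LF n).
    exact: (@xgetPex _ (fun=> 0) [set u | solves 0 1 (F n) u] (ex_intro _ u su)).
  have [LUn _ _] := sUn.
  have /andP[c0 _] := c01 n; have /andP[_ /ltW cS1] := c01 n.+1.
  have sD := solves_init cS1 (solvesB sU sUn).
  have c1 : c n <= 1 by have := c01 n; lra.
  have [LD _] := LpB p1 (mI 0 1) LFoo (LF n).
  have [LDn _] := LpS p1 (mI 0 (c n)) (mI 0 1) (@subitv_init 0 (c n) 1 c1) LD.
  (* Up to c n the total data agree with F n; on the next interval they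
     differ by g n, so there U differs from the solution for F n by w n. *)
  have D0 : ae_eq_on `[0, c n] (fun t => U t - sol (F n) t) (fun=> 0).
    apply: solves_unique c0 LDn (Lp0 X0 0 (c n)) _ _ (solves0 0 (c n)).
      apply: ae_imp (ae_neq (c n)) => t /eqP tc; rewrite /= in_itv/= => /andP[_ t_c].
      by rewrite (Foo_F n) ?subrr// lt_neqAle tc.
    exact: solves_init c1 (solvesB sU sUn).
  have sJ := solves_tail c0 (ltW (c_lt n)) D0 sD.
  have [LDJ _] := LpS p1 (mI _ _) (mI 0 1) (@J_01 n) LD.
  have Dw : ae_eq_on `[c n, c n.+1] (fun t => U t - sol (F n) t) (w n).
    apply: solves_unique (c_lt n) LDJ Lg _ sJ sw.
    apply: ae_imp (ae_neq (c n.+1)) => t /eqP tc; rewrite /= in_itv/= => /andP[ct t_c].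
    have Et : E n t by rewrite /E/= in_itv/= ct lt_neqAle tc.
    by rewrite (Foo_in _ _ Et) (F_in n _ _ Et) ltnn subr0.
  have [LUU nUU] := LpB p1 (mI 0 1) LU LUn.
  have [LUUJ nUUJ] := LpS p1 (mI _ _) (mI 0 1) (@J_01 n) LUU.
  have [_ nw] := ae_eq_Lp_norm p1 (mI _ _) LUUJ (let: And3 L _ _ := sw in L.1) Dw.
  by move: Mw; rewrite nw /M; lra.
have := main (Num.truncn (Lp_norm p `[0, 1] U)).+1.
by rewrite leNgt truncnS_gt.
Qed.

End Solutions.

(** * Perturbation of the maximal regularity constant *)

Section Constants.
Context {R : realType} {X0 X1 : completeNormedModType R}.
Notation mu := (@lebesgue_measure R).
Variables (iota : {linear X1 -> X0}) (p : R).
Hypotheses (iota_cont : continuous iota) (p1 : 1 < p).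

(** The constants over which [max_reg_const] takes the infimum. *)
Definition reg_bound (A : X1 -> X0) (a b C : R) : Prop := 0 < C /\
  forall f u, Lp p `[a, b] f -> is_solution p iota A a b f u ->
    E1_norm p iota `[a, b] u <= C * Lp_norm p `[a, b] f.

Lemma reg_bound_le (A : X1 -> X0) (a b C C' : R) : C <= C' ->
  reg_bound A a b C -> reg_bound A a b C'.
Proof.
move=> CC' [C0 HC]; split; first exact: lt_le_trans CC'.
by move=> f u Lf su; apply: le_trans (HC f u Lf su) _; rewrite ler_wpM2r ?Lp_norm_ge0.
Qed.

(** The point where the boundedness of the solution operator is used: without
    it, [max_reg_const] would be the infimum of an empty set. *)
Lemma ex_reg_bound (A : {linear X1 -> X0}) (a b : R) : continuous A -> a < b ->
  (forall c d, c < d -> maximal_regularity p iota A c d) ->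
  exists C, reg_bound A a b C.
Proof.
move=> cA ab mrA.
have [C C0 HC] := maximal_regularity_bounded iota_cont p1 cA mrA ab.
have [K K0 HK] := E1_norm_solution iota_cont p1 cA.
exists (K * C + 1); split; first by rewrite ltr_wpDl// mulr_ge0.
move=> f u Lf su; apply: le_trans (HK _ _ _ _ Lf su) _.
rewrite mulrDl mul1r lerD2r -mulrA ler_wpM2l//; apply: HC => //.
exact/is_solutionP.
Qed.

Lemma reg_const_le (A : X1 -> X0) (a b C : R) : reg_bound A a b C ->
  max_reg_const p iota A a b <= C.
Proof. by move=> HC; apply: ge_inf => //; exists 0 => x [/ltW]. Qed.

Lemma reg_const_ge0 (A : X1 -> X0) (a b : R) : (exists C, reg_bound A a b C) ->
  0 <= max_reg_const p iota A a b.
Proof. by move=> [C HC]; apply: lb_le_inf; [exists C|move=> x [/ltW]]. Qed.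

Lemma reg_const_lt (A : X1 -> X0) (a b C : R) : (exists C, reg_bound A a b C) ->
  max_reg_const p iota A a b < C -> reg_bound A a b C.
Proof.
move=> [C1 HC1] mC.
have [C2 HC2 C2C] : exists2 C2, reg_bound A a b C2 & C2 < C.
  by apply: inf_lt mC; exists C1.
exact: reg_bound_le (ltW C2C) HC2.
Qed.

(** A solution for B is a solution for A with data f + (A - B) u, and the term
    C delta |u| is absorbed on the left. *)
Lemma reg_bound_perturb (A B : {linear X1 -> X0}) (a b C delta : R) :
  continuous A -> continuous B -> 0 <= delta ->
  (forall v, `|A v - B v| <= delta * `|v|) -> C * delta < 1 ->
  reg_bound A a b C -> reg_bound B a b (C / (1 - C * delta)).
Proof.
move=> cA cB d0 HAB Cd [C0 HC]; have Cd0 : 0 < 1 - C * delta by rewrite subr_gt0.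
split; first by rewrite divr_gt0.
move=> f u Lf [Eu eqn tu]; have [Wu Lu] := Eu.
have mI : measurable (`[a, b]%classic : set (measurableTypeR R)) by exact: measurable_itv.
have [Lh nh] : Lp p `[a, b] (fun t => A (u t) - B (u t)) /\
    Lp_norm p `[a, b] (fun t => A (u t) - B (u t)) <= delta * Lp_norm p `[a, b] u.
  apply: Lp_dominated => //; last by apply: aeW => t _; exact: HAB.
  by apply: strongly_measurableB; apply: strongly_measurable_comp => //; case: Lu.
have [Lg ng] := LpD p1 mI Lf Lh.
have su : is_solution p iota A a b (fun t => f t + (A (u t) - B (u t))) u.
  split => //; apply: ae_imp eqn => t eqn It; rewrite -eqn//.
  by rewrite -addrA [B (u t) + _]addrC subrK.
have H := HC _ _ Lg su.
have nu : Lp_norm p `[a, b] u <= E1_norm p iota `[a, b] u.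
  by rewrite /E1_norm lerDr addr_ge0 ?Lp_norm_ge0.
rewrite mulrAC ler_pdivlMr// mulrBr mulr1 lerBlDr; apply: le_trans H _.
have -> : C * Lp_norm p `[a, b] f + E1_norm p iota `[a, b] u * (C * delta) =
  C * (Lp_norm p `[a, b] f + delta * E1_norm p iota `[a, b] u) by ring.
rewrite ler_pM2l//; apply: le_trans ng _; rewrite lerD2l; apply: le_trans nh _.
by rewrite ler_wpM2l.
Qed.

(** The threshold for delta depends on the constant of A only.  Both estimates
    apply [reg_bound_perturb] to a constant within e / 2 of the infimum for A:
    from A to B it gives the upper bound; from B to A it excludes that the
    infimum for B is smaller by e. *)
Lemma reg_const_close (A B : {linear X1 -> X0}) (a b e delta : R) :
  continuous A -> continuous B ->
  (exists C, reg_bound A a b C) -> (exists C, reg_bound B a b C) ->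
  0 < e -> 0 <= delta -> (forall v, `|B v - A v| <= delta * `|v|) ->
  delta < (e / 2) / (max_reg_const p iota A a b + e) ^+ 2 ->
  `|max_reg_const p iota B a b - max_reg_const p iota A a b| < e.
Proof.
move=> cA cB bA bB e0 d0 HBA.
have HAB v : `|A v - B v| <= delta * `|v| by rewrite distrC.
have := reg_const_ge0 bA; have := reg_const_ge0 bB.
set mA := max_reg_const _ _ A _ _; set mB := max_reg_const _ _ B _ _.
move=> mB0 mA0; rewrite ltr_pdivlMr; last by rewrite exprn_gt0// ltr_wpDl.
rewrite expr2 => small.
have key C : 0 < C -> C < mA + e -> C * delta < 1 /\ (mA + e) * C * delta < e / 2.
  move=> C0 Cme.
  have H : (mA + e) * C * delta < e / 2.
    apply: le_lt_trans small.
    rewrite mulrC; apply: ler_wpM2l => //; apply: ler_wpM2l; last exact: ltW.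
    by rewrite addr_ge0 ?(ltW e0).
  split => //; have me0 : 0 < mA + e by rewrite ltr_wpDl.
  rewrite -(ltr_pM2l me0) mulrA mulr1; apply: lt_le_trans H _; lra.
rewrite ltr_norml; apply/andP; split.
- rewrite ltNge; apply/negP => mBA.
  have C0 : 0 < mA - e / 2 by lra.
  have [Cd H] := key _ C0 ltac:(lra).
  have bC : reg_bound B a b (mA - e / 2) by apply: reg_const_lt => //; rewrite -/mB; lra.
  have := reg_const_le (reg_bound_perturb cB cA d0 HBA Cd bC).
  rewrite -/mA ler_pdivlMr ?subr_gt0// => H2.
  have : 0 <= e * (mA - e / 2) * delta by rewrite !mulr_ge0// ltW.
  nra.
- have C0 : 0 < mA + e / 2 by lra.
  have [Cd H] := key _ C0 ltac:(lra).
  have bC : reg_bound A a b (mA + e / 2) by apply: reg_const_lt => //; rewrite -/mA; lra.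
  have := reg_const_le (reg_bound_perturb cA cB d0 HAB Cd bC).
  rewrite -/mB => H2; rewrite ltrBlDr; apply: le_lt_trans H2 _.
  rewrite ltr_pdivrMr ?subr_gt0//; nra.
Qed.

(** The infimum that defines the operator norm is attained. *)
Lemma op_norm_bound (h : X1 -> X0) : (exists2 K, 0 <= K & forall v, `|h v| <= K * `|v|) ->
  0 <= op_norm h /\ forall v, `|h v| <= op_norm h * `|v|.
Proof.
move=> [K K0 HK]; split.
  by apply: lb_le_inf; [exists K|move=> x []].
move=> v; have [->|v0] := eqVneq v 0.
  by have := HK 0; rewrite normr0 !mulr0.
rewrite -ler_pdivrMr ?normr_gt0//; apply: lb_le_inf; first by exists K.
by move=> C [_ HC]; rewrite ler_pdivrMr ?normr_gt0.
Qed.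

End Constants.

Theorem lemma3p1 (R : realType) (X0 X1 : completeNormedModType R)
  (iota : {linear X1 -> X0}) (p t0 : R)
  (A : R -> X0 -> {linear X1 -> X0})
  (iota_inj : injective iota)
  (iota_cont : continuous iota)
  (iota_dense : dense (range iota))
  (p_gt1 : 1 < p)
  (t0_gt0 : 0 < t0)
  (A_bounded : forall t u, t0 <= t -> Xp p iota u -> continuous (A t u))
  (A_cont : continuous_on_Xp p iota `[t0, +oo[
     (fun B C : {linear X1 -> X0} => op_norm (fun v => B v - C v)) A)
  (A_lip : forall r : R, 0 < r -> exists2 L : R, 0 < L &
     forall (u1 u2 : X0) (v : X1) (t : R),
       Xp p iota u1 -> Xp p iota u2 ->
       Xp_norm p iota u1 <= r -> Xp_norm p iota u2 <= r ->
       t0 <= t <= t0 + r ->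
       `|A t u1 v - A t u2 v| <= L * Xp_norm p iota (u1 - u2) * `|v|)
  (A_max_reg : forall t u, t0 <= t -> Xp p iota u ->
     forall a b : R, a < b -> maximal_regularity p iota (A t u) a b)
  (r : R) (r_gt0 : 0 < r) :
  continuous_on_Xp p iota `[t0, t0 + r] (fun x y : R => `|x - y|)
    (fun t u => max_reg_const p iota (A t u) t0 (t0 + r)).
Proof.
move=> t u; rewrite /= in_itv/= => /andP[t0t _] Xu e e0.
have bounds s w : t0 <= s -> Xp p iota w ->
    exists C, reg_bound iota p (A s w) t0 (t0 + r) C.
  move=> t0s Xw; apply: ex_reg_bound => //; [exact: A_bounded|by rewrite ltrDl|].
  exact: A_max_reg.
have m0 := reg_const_ge0 (bounds t u t0t Xu).
set m := max_reg_const _ _ _ _ _ in m0.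
have tT : `[t0, +oo[%classic t by rewrite /= in_itv/= t0t.
have d0 : 0 < (e / 2) / (m + e) ^+ 2.
  by rewrite divr_gt0 ?divr_gt0// exprn_gt0// ltr_wpDl.
have [d dpos Hd] := A_cont t u tT Xu _ d0; exists d => // s w.
rewrite /= in_itv/= => /andP[t0s _] Xw st wu.
have sT : `[t0, +oo[%classic s by rewrite /= in_itv/= t0s.
have [K1 K10 HK1] := linear_norm_bound (A_bounded t u t0t Xu).
have [K2 K20 HK2] := linear_norm_bound (A_bounded s w t0s Xw).
have [|n0 Hn] := @op_norm_bound _ X0 X1 (fun v => A s w v - A t u v).
  exists (K2 + K1); first exact: addr_ge0.
  by move=> v; rewrite mulrDl; apply: le_trans (ler_normB _ _) (lerD (HK2 v) (HK1 v)).
apply: (reg_const_close p_gt1 _ _ (bounds t u t0t Xu)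
  (bounds s w t0s Xw) e0 n0 Hn (Hd s w sT Xw st wu)); exact: A_bounded.
Qed.
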